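(* For each of the three quadruples $S\in\{(P_1,P_2,P_3,P_4),\,(P_1,P_2,P_3,P_5),\,(P_2,P_3,P_4,P_5)\}$, as formal power series in $x$, $$\sum_{n\ge 0}|\mathcal{M}_n(S)|\,x^n=\frac{1-3x+4x^2-x^3}{(1-x)^4}.$$
   Context: A matching with $n$ arcs is a partition of $\{1,2,\ldots,2n\}$ into blocks of size 2, called arcs; an arc is written $[a,b]$ with $a<b$, where $a$ is its opener and $b$ its closer. For $n=0$ there is exactly one (empty) matching. A matching is Stoimenow if it contains no pair of arcs $[i,\ell],[i+1,k]$ with $i+1<k<\ell$ (Type 1) and no pair of arcs $[k,j+1],[\ell,j]$ with $k<\ell<j$ (Type 2). A matching $M$ contains a pattern (a matching) $P$ with $m$ arcs if some $m$ arcs of $M$ become $P$ after their $2m$ endpoints are relabelled $1,\ldots,2m$ in the order-preserving way; otherwise $M$ avoids $P$. $\mathcal{M}_n(S)$ denotes the set of Stoimenow matchings with $n$ arcs avoiding every pattern in $S$. The patterns are $P_1=\{[1,3],[2,7],[4,5],[6,8]\}$, $P_2=\{[1,3],[2,5],[4,7],[6,8]\}$, $P_3=\{[1,2],[3,5],[4,6],[7,8]\}$, $P_4=\{[1,2],[3,5],[4,7],[6,8]\}$, $P_5=\{[1,3],[2,5],[4,6],[7,8]\}$. *)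

(* Defs.v *)
From mathcomp Require Import all_boot all_order all_algebra.

Set Implicit Arguments.
Unset Strict Implicit.
Unset Printing Implicit Defensive.

Import GRing.Theory.

(* The point i of {1, ..., 2n} is the element of value i - 1 of 'I_n.*2; all
   notions below only compare points or ask that they be consecutive, so the
   shift is harmless. *)
Definition is_matching n (M : {set {set 'I_n.*2}}) : bool :=
  partition M [set: 'I_n.*2] && [forall B in M, #|B| == 2].

Definition is_arc n (M : {set {set 'I_n.*2}}) (a b : 'I_n.*2) : bool :=
  (a < b) && ([set a; b] \in M).

(* Arcs [i, l] and [i + 1, k] with i + 1 < k < l. *)
Definition has_type1 n (M : {set {set 'I_n.*2}}) : bool :=
  [exists i : 'I_n.*2, exists i' : 'I_n.*2,
   exists k : 'I_n.*2, exists l : 'I_n.*2,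
    [&& i' == i.+1 :> nat, i' < k, k < l, is_arc M i l & is_arc M i' k]].

(* Arcs [k, j + 1] and [l, j] with k < l < j. *)
Definition has_type2 n (M : {set {set 'I_n.*2}}) : bool :=
  [exists j : 'I_n.*2, exists j' : 'I_n.*2,
   exists k : 'I_n.*2, exists l : 'I_n.*2,
    [&& j' == j.+1 :> nat, k < l, l < j, is_arc M k j' & is_arc M l j]].

Definition is_stoimenow n (M : {set {set 'I_n.*2}}) : bool :=
  [&& is_matching M, ~~ has_type1 M & ~~ has_type2 M].

(* [f] is the inverse of the order-preserving relabelling of the endpoints of
   the chosen arcs [A] of [M]: [A] becomes [P] when [f x] is relabelled [x]. *)
Definition contains n m (M : {set {set 'I_n.*2}}) (P : {set {set 'I_m.*2}}) :
    bool :=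
  [exists A : {set {set 'I_n.*2}}, exists f : {ffun 'I_m.*2 -> 'I_n.*2},
    [&& A \subset M, #|A| == m,
        [forall x : 'I_m.*2, forall y : 'I_m.*2, (x < y) ==> (f x < f y)]
      & A == [set f @: (B : {set 'I_m.*2}) | B in P]]].

Definition avoids n m (M : {set {set 'I_n.*2}}) (P : {set {set 'I_m.*2}}) :
    bool := ~~ contains M P.

Definition stoimenow_avoiding n m (S : {set {set {set 'I_m.*2}}}) :
    {set {set {set 'I_n.*2}}} :=
  [set M | is_stoimenow M & [forall P in S, avoids M P]].

(* [arc8 a b] is the arc [a, b] in the labels 1, ..., 8. *)
Definition arc8 (a b : nat) : {set 'I_4.*2} :=
  [set (inord a.-1 : 'I_8); (inord b.-1 : 'I_8)].

Definition P1 : {set {set 'I_4.*2}} :=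
  [set arc8 1 3; arc8 2 7; arc8 4 5; arc8 6 8].
Definition P2 : {set {set 'I_4.*2}} :=
  [set arc8 1 3; arc8 2 5; arc8 4 7; arc8 6 8].
Definition P3 : {set {set 'I_4.*2}} :=
  [set arc8 1 2; arc8 3 5; arc8 4 6; arc8 7 8].
Definition P4 : {set {set 'I_4.*2}} :=
  [set arc8 1 2; arc8 3 5; arc8 4 7; arc8 6 8].
Definition P5 : {set {set 'I_4.*2}} :=
  [set arc8 1 3; arc8 2 5; arc8 4 6; arc8 7 8].

Local Open Scope ring_scope.

(* Formal power series, given by their coefficients. *)
Definition fps (R : Type) : Type := nat -> R.

Definition fps_of_poly (R : fieldType) (p : {poly R}) : fps R :=
  fun n => p`_n.

Definition fps_mul (R : fieldType) (f g : fps R) : fps R :=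
  fun n => \sum_(i < n.+1) f i * g (n - i)%N.

(* The first [n] coefficients of 1 / f, obtained by solving f * g = 1 for the
   successive coefficients of g (meaningful when [f 0 != 0]). *)
Fixpoint fps_inv_coefs (R : fieldType) (f : fps R) (n : nat) : seq R :=
  if n is n'.+1 then
    let s := fps_inv_coefs f n' in
    rcons s (((n' == 0)%:R - \sum_(i < n') f i.+1 * s`_(n' - i.+1)) / f 0%N)
  else [::].

Definition fps_inv (R : fieldType) (f : fps R) : fps R :=
  fun n => (fps_inv_coefs f n.+1)`_n.

Definition fps_div (R : fieldType) (f g : fps R) : fps R :=
  fps_mul f (fps_inv g).

Lemma size_fps_inv_coefs (R : fieldType) (f : fps R) n :
  size (fps_inv_coefs f n) = n.
Proof. by elim: n => //= n IH; rewrite size_rcons IH. Qed.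

Lemma nth_fps_inv_coefs (R : fieldType) (f : fps R) n i :
  (i < n)%N -> (fps_inv_coefs f n)`_i = fps_inv f i.
Proof.
elim: n => // n IH; rewrite ltnS leq_eqVlt => /predU1P[-> //|lt_in].
by rewrite /= nth_rcons size_fps_inv_coefs lt_in IH.
Qed.

Lemma fps_mulfV (R : fieldType) (f : fps R) :
  f 0%N != 0 -> fps_mul f (fps_inv f) =1 fps_of_poly 1.
Proof.
move=> f0 n; rewrite /fps_mul /fps_of_poly coef1.
rewrite big_ord_recl subn0 {1}/fps_inv /= nth_rcons size_fps_inv_coefs.
rewrite ltnn eqxx mulrC divfK //.
under [X in _ + X]eq_bigr => i _.
  rewrite -(@nth_fps_inv_coefs _ f n) /bump /= ?add1n; first over.
  by rewrite ltn_subrL (leq_ltn_trans _ (ltn_ord i)).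
by rewrite subrK.
Qed.

Definition stoimenow_gf m (S : {set {set {set 'I_m.*2}}}) : fps rat :=
  fun n => #|stoimenow_avoiding n S|%:R.

(* Main.v *)
Require Import Defs.
From mathcomp Require Import all_boot all_order all_algebra.
From mathcomp Require Import zify ring lra.

(** Write a matching on the points 0, ..., 2n - 1 as its partner involution p,
and put s = p 0, the first closer, and e = p (2n - 1), the last opener.  In a
Stoimenow matching partners increase along every run of consecutive openers
and along every run of consecutive closers.  If e < s the matching consists of
one run of openers followed by one run of closers, hence p k = n + k.

Otherwise s < e, and the arcs are of four kinds: opening arcs, such as [0, s],
go from points before s to points before e, closing arcs, such as [e, 2n - 1],
from points after s to points after e, middle arcs join two points between s
and e, and long arcs go from before s to after e.  The arc [0, s] can be taken
as the first arc of an occurrence of a pattern, and mostly [e, 2n - 1] as the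
last one, so that the patterns forbid the following configurations:
- P2: an opening arc that crosses a closing arc;
- P3: two middle arcs that cross;
- P4: a middle arc that crosses a closing arc;
- P5: an opening arc that crosses a middle arc;
- P1: a long arc together with a middle arc, and also an opening arc that
  crosses a middle arc lying after another middle arc.
With the monotonicity along runs this makes the matching rigid.  From left to
right, the points from s to e are the closers of the opening arcs, then the
middle arcs, then the openers of the closing arcs; all middle arcs join two
adjacent points, except that under P1, P2, P3, P4 the first middle arc may
contain closers of opening arcs.  What remains free are four numbers:
the opening arcs closed before the first middle arc (at least 1), the arcs
from before s that are either long or closed inside the first middle arc (any
number), the middle arcs (any number) and the closing arcs (at least 1).
There are C(n + 1, 3) such quadruples of sum n.  This is spanning_shape for
P2, P3, P4, P5 and crossing_shape for P1, P2, P3, P4; the quadruple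
P1, P2, P3, P5 is the mirror image of the latter (flip_parametrizes).

Conversely each choice of the four numbers gives a matching of the class
(span_sound, cross_sound), different choices give different matchings
(span_inj, cross_inj), and with the matching p k = n + k the class has
1 + C(n + 1, 3) elements (count_parametrized).  The generating function is
then compared coefficientwise, since 1 / (1 - x)^4 has the coefficients
C(k + 3, 3) (gf_coef). *)

Set Implicit Arguments.
Unset Strict Implicit.
Unset Printing Implicit Defensive.

Import GRing.Theory.

(** * Matchings as involutions of an interval of integers *)

(** Only the values of p below N matter; a function on nat avoids dependent
indices and lets linear arithmetic treat each p x as an unknown. *)
Record matching_involution N (p : nat -> nat) : Prop := MatchingInvolution {
  invol_lt : forall x, x < N -> p x < N;
  invol_neq : forall x, x < N -> p x != x;
  invol_sym : forall x y, x < N -> p x = y -> p y = x }.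

(** The last two fields are the absence of arcs of Type 1 and of Type 2, read
contrapositively as monotonicity of p on adjacent openers and closers. *)
Record stoimenow_involution N (p : nat -> nat) : Prop := StoimenowInvolution {
  stoimenow_matching :> matching_involution N p;
  openers_increasing : forall x, x.+1 < N -> x < p x -> x.+1 < p x.+1 ->
    p x < p x.+1;
  closers_increasing : forall x, x.+1 < N -> p x < x -> p x.+1 < x.+1 ->
    p x < p x.+1 }.

(** The partner function of the matching read from right to left. *)
Definition flip N (p : nat -> nat) x := N.-1 - p (N.-1 - x).

Lemma flip_matching N p :
  matching_involution N p -> matching_involution N (flip N p).
Proof.
case=> plt pne psym; rewrite /flip; split=> [x|x|x y] ltxN.
- by have := plt (N.-1 - x); lia.
- by have := plt (N.-1 - x); have := pne (N.-1 - x); lia.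
- move=> <-; have := plt (N.-1 - x); have := psym (N.-1 - x) _ _ erefl.
  move=> sym lt; rewrite subKn; last by lia.
  by rewrite sym; lia.
Qed.

Lemma flip_stoimenow N p :
  stoimenow_involution N p -> stoimenow_involution N (flip N p).
Proof.
case=> inv pop pcl; split=> [|x xN|x xN]; first exact: flip_matching.
- have := pcl (N.-1 - x.+1); have := @invol_lt _ _ inv (N.-1 - x).
  have := @invol_lt _ _ inv (N.-1 - x.+1).
  by rewrite /flip (_ : (N.-1 - x.+1).+1 = N.-1 - x); lia.
- have := pop (N.-1 - x.+1); have := @invol_lt _ _ inv (N.-1 - x).
  have := @invol_lt _ _ inv (N.-1 - x.+1).
  by rewrite /flip (_ : (N.-1 - x.+1).+1 = N.-1 - x); lia.
Qed.

(** * Increasing runs of integers *)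

Lemma increasing_ge (p : nat -> nat) u k :
  (forall x, u <= x -> x.+1 < u + k -> p x < p x.+1) ->
  forall i, i < k -> p u + i <= p (u + i).
Proof.
move=> incr; elim=> [|i IH] lt_ik; first by rewrite !addn0.
have := incr (u + i); have := IH (ltnW lt_ik); rewrite !addnS; lia.
Qed.

Lemma increasing_le (p : nat -> nat) u k :
  (forall x, u <= x -> x.+1 < u + k -> p x < p x.+1) ->
  forall i, i < k -> p (u + i) + (k.-1 - i) <= p (u + k.-1).
Proof.
move=> incr i lt_ik.
have := @increasing_ge p (u + i) (k - i) _ (k.-1 - i).
rewrite (_ : u + i + (k.-1 - i) = u + k.-1); last by lia.
by apply; [move=> x ? ?; apply: incr; lia | lia].
Qed.

Lemma increasing_lt (p : nat -> nat) u k :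
  (forall x, u <= x -> x.+1 < u + k -> p x < p x.+1) ->
  forall x y, u <= x -> x < y -> y < u + k -> p x < p y.
Proof.
move=> incr x y lux lxy lyk.
have incr' z : x <= z -> z.+1 < x + (u + k - x) -> p z < p z.+1.
  by move=> ? ?; apply: incr; lia.
by have := increasing_ge incr' (i := y - x); rewrite subnKC; lia.
Qed.

(** Applied to p in both directions, this shows that two intervals that p
exchanges increasingly have the same length. *)
Lemma increasing_size (p : nat -> nat) u v k r :
  (forall x, u <= x -> x.+1 < u + k -> p x < p x.+1) ->
  (forall x, u <= x -> x < u + k -> v <= p x < v + r) -> k <= r.
Proof.
move=> incr im; case: k incr im => // k incr im.
have := increasing_ge incr (ltnSn k); have := im u; have := im (u + k); lia.
Qed.

(** An increasing map from an interval to one of the same length has no slack: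
it grows by at least 1 at each step. *)
Lemma increasing_shift (p : nat -> nat) u v k :
  (forall x, u <= x -> x.+1 < u + k -> p x < p x.+1) ->
  (forall x, u <= x -> x < u + k -> v <= p x < v + k) ->
  forall i, i < k -> p (u + i) = v + i.
Proof.
move=> incr im i lt_ik.
have := increasing_ge incr lt_ik; have := increasing_le incr lt_ik.
have := im u; have := im (u + k.-1); lia.
Qed.

(** * The first and the last run of a Stoimenow matching *)

Section FirstRun.
Variables (N : nat) (p : nat -> nat).
Hypothesis st : stoimenow_involution N p.

(** No closer can come before p 0: as long as all points up to x are openers
their partners increase from p 0, so a closer x + 1 < p 0 would be matched with
one of them, whose partner is at least p 0. *)
Lemma first_run_ge x : x < p 0 -> 0 < N -> p 0 <= p x.
Proof.
move=> + N0; elim/ltn_ind: x => -[//|x] IH lx.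
have ltN := invol_lt st N0.
have IHx : p 0 <= p x by apply: IH => //; lia.
have lxN : x.+1 < N by lia.
case: (ltngtP (p x.+1) x.+1) => [cl|op|eq].
- by have := IH _ cl; have := invol_sym st lxN erefl; lia.
- by have := openers_increasing st lxN; lia.
- by have := invol_neq st lxN; lia.
Qed.

Lemma first_run_increasing x : x.+1 < p 0 -> 0 < N -> p x < p x.+1.
Proof.
move=> lx N0; have ltN := invol_lt st N0.
have := first_run_ge lx N0; have := @first_run_ge x.
by have := @openers_increasing _ _ st x; lia.
Qed.
End FirstRun.

Section LastRun.
Variables (N : nat) (p : nat -> nat).
Hypothesis st : stoimenow_involution N p.

Lemma last_run_le x : p N.-1 < x -> x < N -> p x <= p N.-1.
Proof.
move=> gx lx; have ltN : p N.-1 < N by apply: (invol_lt st); lia.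
have := invol_lt st lx.
have := @first_run_ge _ _ (flip_stoimenow st) (N.-1 - x).
by rewrite /flip subn0 subKn; lia.
Qed.

Lemma last_run_increasing x : p N.-1 < x -> x.+1 < N -> p x < p x.+1.
Proof.
move=> gx lx.
have := @last_run_le x; have := @last_run_le x.+1.
by have := @closers_increasing _ _ st x; lia.
Qed.
End LastRun.

(** Here p 0 exceeds every opener, so the points below p 0 are all the openers
and p exchanges the two halves increasingly. *)
Lemma antichain_shape n p : stoimenow_involution n.*2 p -> 0 < n ->
  p n.*2.-1 < p 0 -> forall k, k < n -> p k = n + k.
Proof.
move=> st n0 les.
have N0 : 0 < n.*2 by lia.
have s_lt := invol_lt st N0.
have incF x : 0 <= x -> x.+1 < 0 + p 0 -> p x < p x.+1.
  by move=> _ lx; apply: (first_run_increasing st).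
have incL x : p 0 <= x -> x.+1 < p 0 + (n.*2 - p 0) -> p x < p x.+1.
  by move=> lx ?; apply: (last_run_increasing st); lia.
have imF x : 0 <= x -> x < 0 + p 0 -> p 0 <= p x < p 0 + (n.*2 - p 0).
  move=> _ lx; have := @first_run_ge _ _ st x; have := @invol_lt _ _ st x; lia.
have imL x : p 0 <= x -> x < p 0 + (n.*2 - p 0) -> 0 <= p x < 0 + p 0.
  move=> lx lxN; have := @last_run_le _ _ st x; lia.
have s_n : p 0 = n.
  by have := increasing_size incF imF; have := increasing_size incL imL; lia.
move=> k lk; rewrite -[k in LHS]add0n -[in RHS]s_n.
by apply: (increasing_shift incF _); [move=> x ? ?; have := imF x; lia | lia].
Qed.

(** The closers of the run that starts at p 0 have increasing partners, while
openers of the first run have increasing partners too; if f is the partner of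
the last of the u closers, the first bound gives f >= u - 1 and the second
f <= u - 1. *)
Lemma first_closers N p u : stoimenow_involution N p -> 0 < N ->
  p 0 + u <= N -> (forall x, p 0 <= x -> x < p 0 + u -> p x < x) ->
  u <= p 0 /\ forall k, k < u -> p k = p 0 + k.
Proof.
move=> st N0; case: u => // u luN cl.
have s_lt := invol_lt st N0.
have ltF x : p 0 <= x -> x < p 0 + u.+1 -> p x < p 0.
  move=> gx lx; have := cl _ gx lx.
  have := cl (p x); have := invol_sym st (y := p x) (x := x); lia.
have incC x : p 0 <= x -> x.+1 < p 0 + u.+1 -> p x < p x.+1.
  by move=> gx lx; apply: (closers_increasing st) => //; [lia | apply: cl; lia..].
have incF x : 0 <= x -> x.+1 < 0 + p 0 -> p x < p x.+1.
  by move=> _ lx; apply: (first_run_increasing st).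
have fF := ltF (p 0 + u).
have pf := invol_sym st (x := p 0 + u) (y := p (p 0 + u)).
have p_s := invol_sym st (x := 0) (y := p 0).
have := increasing_ge incC (ltnSn u).
have := increasing_ge incF (i := p (p 0 + u)); rewrite !add0n => gef geu.
have f_u : p (p 0 + u) = u by lia.
split=> [|k lk]; first by lia.
rewrite -[k in LHS]add0n.
apply: (@increasing_shift p 0 (p 0) u.+1) => // x _.
  by move=> ?; apply: incF; lia.
move=> lx; have := @first_run_ge _ _ st x.
have := invol_sym st (x := p 0 + u) (y := u).
have := @increasing_lt p 0 (p 0) incF x u.
by case: (ltngtP x u) => [? | ? | ->]; lia.
Qed.

Lemma last_openers N p c : stoimenow_involution N p -> 0 < N ->
  c <= (p N.-1).+1 -> (forall x, x <= p N.-1 -> p N.-1 < x + c -> x < p x) ->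
  c <= N.-1 - p N.-1 /\ forall k, k < c -> p (p N.-1 - k) = N.-1 - k.
Proof.
move=> st N0 lc op.
have ltN : p N.-1 < N by apply: (invol_lt st); lia.
have f0 : flip N p 0 = N.-1 - p N.-1 by rewrite /flip subn0.
have := @first_closers N (flip N p) c (flip_stoimenow st) N0.
rewrite f0; case=> [|x gx lx|lcs eqp]; [by lia| |].
  have := op (N.-1 - x); have := @invol_lt _ _ st (N.-1 - x).
  by rewrite /flip; lia.
split=> // k lk; apply: (invol_sym st); first by lia.
by have := eqp k lk; have := @invol_lt _ _ st (N.-1 - k); rewrite /flip; lia.
Qed.

(** * Pattern occurrences *)

Definition pattern1 := [:: (1, 3); (2, 7); (4, 5); (6, 8)].
Definition pattern2 := [:: (1, 3); (2, 5); (4, 7); (6, 8)].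
Definition pattern3 := [:: (1, 2); (3, 5); (4, 6); (7, 8)].
Definition pattern4 := [:: (1, 2); (3, 5); (4, 7); (6, 8)].
Definition pattern5 := [:: (1, 3); (2, 5); (4, 6); (7, 8)].

(** The pattern Q, whose arcs are written with the labels 1, ..., 8, occurs at
the increasing positions xs; the label a is the entry of index a - 1. *)
Definition occurs N (p : nat -> nat) (Q : seq (nat * nat)) (xs : seq nat) :=
  [&& size xs == 8, sorted ltn xs, all (fun x => x < N) xs
    & all (fun ab => p (nth 0 xs ab.1.-1) == nth 0 xs ab.2.-1) Q].

Definition avoiding N p Q := forall xs, ~~ occurs N p Q xs.

Definition wf_pattern (Q : seq (nat * nat)) :=
  [&& all (fun ab => [&& 0 < ab.1, ab.1 < ab.2 & ab.2 <= 8]) Q,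
      uniq Q & size Q == 4].

(** * The zones between the first closer and the last opener *)

(** A point at distance d from t lies in the pair that starts at
t + 2 * (d / 2), whence the halving. *)
Lemma adjacent_pairs N p t m : matching_involution N p -> t + m.*2 <= N ->
  (forall j, j < m -> p (t + j.*2) = (t + j.*2).+1) ->
  forall x, t <= x -> x < t + m.*2 -> t <= p x < t + m.*2.
Proof.
move=> inv tN pairs x tx xt; have := pairs (x - t)./2 ltac:(lia).
have : x = t + (x - t)./2.*2 \/ x = (t + (x - t)./2.*2).+1 by lia.
have : t <= t + (x - t)./2.*2 /\ (t + (x - t)./2.*2).+1 < t + m.*2 by lia.
move: (t + (x - t)./2.*2) => y [ty yt] xy py.
have yN : y < N by lia.
have py' := invol_sym inv yN py.
by case: xy => ->; rewrite ?py ?py'; lia.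
Qed.

(** From here on s is the first closer, e the last opener, and s < e.  An
opening arc is recognised by its closer z with p z < s, a closing arc by its
opener i with e < p i, a middle arc by its opener i with s < i and
i < p i < e. *)
Section SeparatedEnds.
Variables (N : nat) (p : nat -> nat) (s e : nat).
Hypothesis st : stoimenow_involution N p.
Hypotheses (ps : p 0 = s) (pe : p N.-1 = e) (lt_se : s < e).

Lemma ends_bounds : [/\ 0 < s, e < N.-1, p s = 0 & p e = N.-1].
Proof.
have N0 : 0 < N.
  by case: N ps pe => [|//] /=; lia.
have := invol_lt st N0; have := invol_neq st N0.
have N1 : N.-1 < N by lia.
have := invol_lt st N1; have := invol_neq st N1.
by have := invol_sym st N0 ps; have := invol_sym st N1 pe; split; lia.
Qed.

Lemma middle_partner x : s < x -> x < e ->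
  [/\ p x < N, p x != x, p x != s & p x != e].
Proof.
have [s0 eN pse pee] := ends_bounds.
move=> sx xe; have xN : x < N by lia.
have sym y : p x = y -> p y = x by apply: (invol_sym st).
split; [exact: (invol_lt st) | exact: (invol_neq st) | |];
  by apply/eqP => /sym; lia.
Qed.

Lemma first_ge x : x < s -> s <= p x.
Proof.
have [s0 eN _ _] := ends_bounds.
by rewrite -ps => lx; apply: (first_run_ge st) => //; lia.
Qed.

Lemma last_le x : e < x -> x < N -> p x <= e.
Proof. by rewrite -pe => gx lx; apply: (last_run_le st). Qed.

(** A crossing of the opening arc of z and the closing arc of i, with the arcs
[0, s] and [e, N - 1] around it, is an occurrence of P2. *)
Lemma closer_before_opener z i : avoiding N p pattern2 ->
  z < e -> p z < s -> s < i -> i <= e -> e < p i -> z < i.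
Proof.
have [s0 eN p_s p_e] := ends_bounds.
move=> av ze pz si ie pi; case: (ltngtP z i) => // [iz|eqiz]; last first.
  by move: pz pi; rewrite eqiz; lia.
have := av [:: 0; p z; s; i; z; e; p i; N.-1]; rewrite /occurs /= ps p_e.
have pi_lt : p i < N by apply: (invol_lt st); lia.
rewrite (invol_sym st _ (erefl (p z))); last by lia.
have := middle_partner (x := z); have := middle_partner (x := i).
have := invol_sym st (x := z) (y := 0); have := invol_sym st (x := i) (y := N.-1).
lia.
Qed.

Lemma middle_noncrossing i j : avoiding N p pattern3 ->
  s < i -> i < j -> j < p i -> p i < p j -> p j < e -> False.
Proof.
have [s0 eN p_s p_e] := ends_bounds.
move=> av si ij jpi pij pje.
have := av [:: 0; s; i; j; p i; p j; e; N.-1]; rewrite /occurs /= ps p_e.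
lia.
Qed.

Lemma middle_closing_noncrossing i j : avoiding N p pattern4 ->
  s < i -> i < j -> j < p i -> p i < e -> e < p j -> False.
Proof.
have [s0 eN p_s p_e] := ends_bounds.
move=> av si ij jpi pie epj.
have pj_lt : p j < N by apply: (invol_lt st); lia.
have := av [:: 0; s; i; j; p i; e; p j; N.-1]; rewrite /occurs /= ps p_e.
have := invol_sym st (x := j) (y := N.-1); lia.
Qed.

Lemma opening_middle_noncrossing i z : avoiding N p pattern5 ->
  s < i -> p z < s -> i < z -> z < p i -> p i < e -> False.
Proof.
have [s0 eN p_s p_e] := ends_bounds.
move=> av si pzs iz zpi pie.
have := av [:: 0; p z; s; i; z; p i; e; N.-1]; rewrite /occurs /= ps p_e.
rewrite (invol_sym st _ (erefl (p z))); last by lia.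
have := invol_sym st (x := z) (y := 0); lia.
Qed.

Lemma long_excludes_middle f i : avoiding N p pattern1 ->
  f < s -> e < p f -> s < i -> i < p i -> p i < e -> False.
Proof.
have [s0 eN p_s p_e] := ends_bounds.
move=> av fs epf si ipi pie.
have pf_lt : p f < N by apply: (invol_lt st); lia.
have := av [:: 0; f; s; i; p i; e; p f; N.-1]; rewrite /occurs /= ps p_e.
have := invol_sym st (x := f) (y := N.-1).
by case: f fs epf pf_lt => [|f] *; lia.
Qed.

Lemma crossing_meets_first_middle z i j : avoiding N p pattern1 ->
  s < i -> i < p i -> p i < j -> j < z -> z < p j -> p j < e -> p z < s ->
  False.
Proof.
have [s0 eN p_s p_e] := ends_bounds.
move=> av si ipi pij jz zpj pje pzs.
have := av [:: 0; p z; s; i; p i; j; z; p j]; rewrite /occurs /= ps.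
rewrite (invol_sym st _ (erefl (p z))); last by lia.
have := invol_sym st (x := z) (y := 0); lia.
Qed.

(** Going down from the closer of the middle arc, every point q inside it
closes an opening arc.  If q is a closer, its partner is smaller than that of
the closer q + 1 and cannot be in the middle without a crossing (P3).  If q is
an opener, its partner is not q + 1 and not one of the closers already treated,
so its arc leaves the middle arc, against P3 or P4. *)
Lemma inside_middle i q : avoiding N p pattern3 -> avoiding N p pattern4 ->
  s < i -> i < q -> q < p i -> p i < e -> p q < s.
Proof.
have [s0 eN p_s p_e] := ends_bounds.
move=> av3 av4 si iq qpi pie.
have [k] := ubnP (p i - q); elim: k q iq qpi => // k IH q iq qpi lek.
have [_ pq pqs pqe] : [/\ p q < N, p q != q, p q != s & p q != e].
  by apply: middle_partner; lia.
have p_pi : p (p i) = i by apply: (invol_sym st) => //; lia.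
have p_pq : p (p q) = q by apply: (invol_sym st) => //; lia.
have [eq_qpi|lt_qpi] : q.+1 = p i \/ q.+1 < p i by lia.
- case: (ltngtP (p q) q) => [cl|op|]; [|exfalso|lia].
  + have := @closers_increasing _ _ st q; rewrite eq_qpi p_pi => pqi.
    rewrite ltnNge leq_eqVlt; apply/negP => /orP[|lt_s]; first by lia.
    by have := @middle_noncrossing (p q) i av3; rewrite p_pq; lia.
  + have neq : p q != p i by apply/eqP => E; move: p_pq; rewrite E p_pi; lia.
    have := @middle_noncrossing i q av3; have := @middle_closing_noncrossing i q av4.
    lia.
- have pq1 : p q.+1 < s by apply: IH; lia.
  case: (ltngtP (p q) q) => [cl|op|]; [|exfalso|lia].
  + by have := @closers_increasing _ _ st q; lia.
  + have neq : p q != p i by apply/eqP => E; move: p_pq; rewrite E p_pi; lia.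
    have neq1 : p q != q.+1 by apply/eqP => E; move: p_pq; rewrite E; lia.
    have := IH (p q); rewrite p_pq.
    have := @middle_noncrossing i q av3; have := @middle_closing_noncrossing i q av4.
    lia.
Qed.

(** After the opener x of a closing arc, the next point cannot close an opening
arc (P2), nor open a middle arc (partners increase along a run of openers), nor
close a middle arc, which would start at or enclose the opener of a closing
arc. *)
Lemma closing_run x y : avoiding N p pattern2 ->
  (forall i q, s < i -> i < q -> q < p i -> p i < e -> p q < s) ->
  s < x -> e < p x -> x <= y -> y <= e -> e < p y.
Proof.
have [s0 eN p_s p_e] := ends_bounds.
move=> av2 inside sx epx; elim: y => [|y IH] xy ye; first by lia.
have [<-//|xy'] : x = y.+1 \/ x <= y by lia.
have [->|ye'] : y.+1 = e \/ y.+1 < e by lia.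
  by rewrite p_e.
have epy : e < p y by apply: IH; lia.
have [py_lt py pys pye] : [/\ p y.+1 < N, p y.+1 != y.+1, p y.+1 != s & p y.+1 != e].
  by apply: middle_partner; lia.
have p_py : p (p y.+1) = y.+1 by apply: (invol_sym st) => //; lia.
case: (ltngtP (p y.+1) y.+1) => [cl|op|]; last by lia.
- have := closer_before_opener (z := y.+1) (i := x) av2.
  have := inside (p y.+1) y; rewrite p_py.
  have [E|] : p y.+1 = y \/ p y.+1 != y by lia.
  + by rewrite E in p_py; lia.
  + lia.
- by have := openers_increasing st (x := y); lia.
Qed.

(** When no point after t has its partner before t, a middle arc that opens at
t can only enclose closers of opening arcs, hence nothing: it is [t, t + 1].
The argument repeats at t + 2, until a closing arc opens; from there on
closing_run applies. *)
Lemma tail_shape t : avoiding N p pattern2 ->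
  (forall i q, s < i -> i < q -> q < p i -> p i < e -> p q < s) ->
  s < t -> t <= e -> (forall x, t <= x -> x <= e -> t <= p x) ->
  exists m, [/\ t + m.*2 <= e, forall j, j < m -> p (t + j.*2) = (t + j.*2).+1
    & forall x, t + m.*2 <= x -> x <= e -> e < p x].
Proof.
have [s0 eN p_s p_e] := ends_bounds.
move=> av2 inside; have [k] := ubnP (e - t); elim: k t => // k IH t lek st' te cl.
have [E|lt_te] := eqVneq t e.
  exists 0; rewrite addn0; split=> // x lx xe.
  have xe' : x = e by lia.
  by rewrite xe' p_e; lia.
have [pt_lt pt pts pte] : [/\ p t < N, p t != t, p t != s & p t != e].
  by apply: middle_partner; lia.
have p_pt : p (p t) = t by apply: (invol_sym st) => //; lia.
have := cl t; have [pe'|pe'] := ltnP e (p t).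
  exists 0; rewrite addn0; split=> // x lx xe.
  by apply: closing_run lx xe.
move=> clt.
have pt1 : p t = t.+1.
  apply/eqP; rewrite eqn_leq andbC; apply/andP; split; first by lia.
  by have := inside t t.+1; have := cl t.+1; lia.
have pt1' : p t.+1 = t by rewrite -pt1.
have [||||m [m_e m_sing m_ml]] := IH t.+2; [lia..| |].
  move=> x lx xe; have := cl x.
  have [xN] : x < N by lia.
  have := invol_sym st (x := x) (y := t); have := invol_sym st (x := x) (y := t.+1).
  lia.
exists m.+1; split; [lia| |].
- case=> [_|j lj]; first by rewrite double0 addn0.
  by rewrite (_ : t + j.+1.*2 = t.+2 + j.*2); [apply: m_sing; lia | lia].
- by move=> x lx; apply: m_ml; lia.
Qed.

(** The first closer of an opening arc after t would come right after a closer
with a larger partner, against monotonicity along runs of closers, or right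
after the opener of a closing arc, against P2, or right after the opener of a
middle arc, which the hypothesis on p i.+1 excludes. *)
Lemma no_opening_closer_after t : avoiding N p pattern2 ->
  s < t -> s <= p t ->
  (forall i, t <= i -> i < p i -> p i < e -> s <= p i.+1) ->
  forall x, t <= x -> x < e -> s <= p x.
Proof.
have [s0 eN p_s p_e] := ends_bounds.
move=> av2 lst spt mid; elim=> [|y IH] tx xe; first by lia.
have [<-//|ty] : t = y.+1 \/ t <= y by lia.
have spy : s <= p y by apply: IH; lia.
have [py_lt py pys pye] : [/\ p y < N, p y != y, p y != s & p y != e].
  by apply: middle_partner; lia.
rewrite leqNgt; apply/negP => pz.
have [cl|op] : p y < y \/ y < p y by lia.
- by have := closers_increasing st (x := y); lia.
- have := closer_before_opener (z := y.+1) (i := y) av2.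
  by have := mid y; lia.
Qed.

(** The points below U are those of the first run that are matched below q, and
[q, e] consists of the openers of the closing arcs.  The latter take the last closers, so the
remaining s - U points of the first run and the remaining closers of the last
run are exchanged increasingly: these are the long arcs. *)
Lemma outer_shape q U : s < q -> q <= e -> U <= s ->
  (forall x, s <= x -> x < q -> p x < U \/ s <= p x < q) ->
  (forall x, x < U -> p x < q) ->
  (forall x, q <= x -> x <= e -> e < p x) ->
  [/\ N = e.+1 + (s - U) + (e.+1 - q),
      forall i, i < s - U -> p (U + i) = e.+1 + i
    & forall i, i < e.+1 - q -> p (q + i) = e.+1 + (s - U) + i].
Proof.
have [s0 eN p_s p_e] := ends_bounds.
move=> sq qe Us mid front closing; set c := e.+1 - q.
have N0 : 0 < N by lia.
have [] := last_openers (c := c) st N0; rewrite ?pe; first by lia.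
  by move=> x xe ex; have := closing x; lia.
move=> c_le p_last.
have p_closing x : q <= x -> x <= e -> N - c <= p x.
  move=> qx xe; have := p_last (e - x).
  by rewrite subKn; lia.
have p_end x : N - c <= x -> x < N -> q <= p x.
  move=> cx xN; have := p_last (N.-1 - x) => /(_ ltac:(lia)) E.
  have := invol_sym st _ E.
  by rewrite subKn; lia.
have incF x : U <= x -> x.+1 < U + (s - U) -> p x < p x.+1.
  by move=> _ lx; apply: (first_run_increasing st) => //; rewrite ps; lia.
have incL x : e.+1 <= x -> x.+1 < e.+1 + (N - c - e.+1) -> p x < p x.+1.
  by move=> ? ?; apply: (last_run_increasing st); rewrite ?pe; lia.
have imF x : U <= x -> x < U + (s - U) ->
    e.+1 <= p x < e.+1 + (N - c - e.+1).
  move=> Ux xs; have xN : x < N by lia.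
  have := invol_lt st xN; have p_px := invol_sym st xN erefl.
  have := @first_ge x; have := mid (p x); have := p_closing (p x).
  by have := p_end (p x); rewrite p_px; lia.
have imL x : e.+1 <= x -> x < e.+1 + (N - c - e.+1) -> U <= p x < U + (s - U).
  move=> ex xe; have xN : x < N by lia.
  have := invol_lt st xN; have p_px := invol_sym st xN erefl.
  have := @last_le x; have := mid (p x); have := front (p x).
  by have := p_closing (p x); rewrite p_px; lia.
have := increasing_size incF imF; have := increasing_size incL imL.
move=> le1 le2; have r_eq : N - c - e.+1 = s - U by lia.
split; [by lia | |].
- by apply: (increasing_shift incF) => x Ux xs; have := imF x Ux xs; lia.
- move=> i li; have := p_last (c.-1 - i).
  by rewrite (_ : e - (c.-1 - i) = q + i); lia.
Qed.

(** s + u is the first opener after s. *)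
Lemma first_middle_opener :
  exists u, [/\ 0 < u <= s, s + u <= e, s + u < p (s + u),
     forall k, k < u -> p k = s + k & forall x, s <= x -> x < s + u -> p x < u].
Proof.
have [s0 eN p_s p_e] := ends_bounds.
have ex : exists x, (s < x) && (x < p x) by exists e; rewrite p_e; lia.
case: (ex_minnP ex) => t /andP[st' tp] min_t.
have te : t <= e by apply: min_t; rewrite p_e; lia.
have N0 : 0 < N by lia.
have cl x : p 0 <= x -> x < p 0 + (t - s) -> p x < x.
  rewrite ps => sx xt; have [->|sx'] : x = s \/ s < x by lia.
    by rewrite p_s.
  have := min_t x; have := @invol_neq _ _ st x; lia.
have [|le_us p_first] := first_closers st N0 _ cl; first by rewrite ps; lia.
rewrite ps in le_us p_first.
exists (t - s); rewrite subnKC; last by lia.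
split=> //; [by lia | move=> x sx xt].
have := p_first (x - s); rewrite subnKC // => /(_ ltac:(lia)) E.
by have := invol_sym st _ E; lia.
Qed.

End SeparatedEnds.

(** * The two explicit families of matchings *)

(** The first alternative has u opening arcs closed before the middle arcs,
v - u long or crossing arcs, w - v middle arcs and n - w closing arcs.  The
second one makes all arcs of the first kind with v = n, so that the formulas
below give the matching k -> n + k without a separate case. *)
Definition valid n u v w :=
  [&& 0 < u, u <= v, v <= w & w < n] || [&& u == n, v == n & w == n].

(** The k-th arc, in the order of the openers, joins span_op u v w k to
span_cl n u v w k: the v - u arcs that follow the first u ones span the whole
middle. *)
Definition span_op u v w k :=
  if k < v then k else if k < w then u + k.*2 - v else u + w - v + k.
Definition span_cl n u v w k :=
  if k < u then v + k else if k < v then k + w + n - v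
  else if k < w then (u + k.*2 - v).+1 else n + k.

(** When there are middle arcs (v < w), the first one, number v, joins v + u to
2 * v + 1, and the v - u arcs before it are closed inside it instead of
spanning the whole middle. *)
Definition cross_op u v w k :=
  if v == w then span_op u v w k
  else if k < v then k else if k == v then v + u else if k < w then k.*2
  else w + k.
Definition cross_cl n u v w k :=
  if v == w then span_cl n u v w k
  else if k < u then v + k else if k < v then (v + k).+1
  else if k < w then k.*2.+1 else n + k.

(** The disjuncts are the opening, long, middle and closing arcs.  Parity is
ignored in the third one: the weaker description, free of the index k, is
enough to exclude patterns and leaves purely linear conditions. *)
Definition span_arc n u v w x y :=
  [|| (x < u) && (y == v + x),
      [&& u <= x, x < v & y + v == x + w + n],
      [&& u + v <= x, y == x.+1 & y + v < u + w.*2]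
    | [&& u + w.*2 <= x + v, x + v < u + w + n & y + u + w == x + n + v]].

Definition cross_arc n u v w x y :=
  if v == w then span_arc n u v w x y
  else [|| (x < u) && (y == v + x),
      [&& u <= x, x < v & y == (v + x).+1],
      (x == v + u) && (y == v.*2.+1),
      [&& v.*2.+2 <= x, y == x.+1 & y < w.*2]
    | [&& w.*2 <= x, x < w + n & y + w == x + n]].

Lemma span_arcP n u v w k : valid n u v w -> k < n ->
  span_arc n u v w (span_op u v w k) (span_cl n u v w k).
Proof.
rewrite /valid /span_arc /span_op /span_cl.
case: (ltnP k u); case: (ltnP k v); case: (ltnP k w); lia.
Qed.

Lemma cross_arcP n u v w k : valid n u v w -> k < n ->
  cross_arc n u v w (cross_op u v w k) (cross_cl n u v w k).
Proof.
move=> val kn; rewrite /cross_arc /cross_op /cross_cl; case: eqP => [_|/eqP vw].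
  exact: span_arcP.
move: val; rewrite /valid; have [E|kv] := eqVneq k v.
  by subst k; rewrite ltnn; case: (ltnP v u); case: (ltnP v w); lia.
by case: (ltnP k u); case: (ltnP k v); case: (ltnP k w); lia.
Qed.

(** Together the op k and cl k are 2 * n distinct points below 2 * n: the arcs
form a matching. *)
Record arc_system n (op cl : nat -> nat) : Prop := ArcSystem {
  arc_ordered : forall k, k < n -> op k < cl k;
  arc_bounded : forall k, k < n -> cl k < n.*2;
  op_inj : forall k l, k < n -> l < n -> op k = op l -> k = l;
  cl_inj : forall k l, k < n -> l < n -> cl k = cl l -> k = l;
  op_neq_cl : forall k l, k < n -> l < n -> op k != cl l }.

Record realizes n (op cl p : nat -> nat) : Prop := Realizes {
  realizes_matching :> matching_involution n.*2 p;
  realizes_arc : forall k, k < n -> p (op k) = cl k;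
  realizes_opener : forall x, x < n.*2 -> x < p x -> exists2 k, k < n & x = op k }.

Record parametrizes n (Qs : seq (seq (nat * nat)))
    (op cl : nat -> nat -> nat -> nat -> nat) : Prop := Parametrizes {
  par_system : forall u v w, valid n u v w -> arc_system n (op u v w) (cl u v w);
  par_sound : forall u v w p, valid n u v w -> realizes n (op u v w) (cl u v w) p ->
    stoimenow_involution n.*2 p /\ {in Qs, forall Q, avoiding n.*2 p Q};
  par_complete : forall p, stoimenow_involution n.*2 p ->
    {in Qs, forall Q, avoiding n.*2 p Q} -> exists u v w, valid n u v w /\
    forall k, k < n -> p (op u v w k) = cl u v w k;
  par_inj : forall u v w u' v' w' p, valid n u v w -> valid n u' v' w' ->
    realizes n (op u v w) (cl u v w) p -> realizes n (op u' v' w') (cl u' v' w') p ->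
    [/\ u = u', v = v' & w = w'] }.

Lemma span_system n u v w : valid n u v w ->
  arc_system n (span_op u v w) (span_cl n u v w).
Proof.
rewrite /valid /span_op /span_cl => val; split.
- move=> k kn; case: (ltnP k u); case: (ltnP k v); case: (ltnP k w); lia.
- move=> k kn; case: (ltnP k u); case: (ltnP k v); case: (ltnP k w); lia.
- move=> k l kn ln; case: (ltnP k v); case: (ltnP k w);
    case: (ltnP l v); case: (ltnP l w); lia.
- move=> k l kn ln; case: (ltnP k u); case: (ltnP k v); case: (ltnP k w);
    case: (ltnP l u); case: (ltnP l v); case: (ltnP l w); lia.
- move=> k l kn ln; case: (ltnP k v); case: (ltnP k w);
    case: (ltnP l u); case: (ltnP l v); case: (ltnP l w); lia.
Qed.

Lemma cross_system n u v w : valid n u v w ->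
  arc_system n (cross_op u v w) (cross_cl n u v w).
Proof.
rewrite /cross_op /cross_cl; have [->|vw] := eqVneq v w; first exact: span_system.
rewrite /valid => val; split.
- move=> k kn; case: (ltngtP k v); case: (ltnP k u); case: (ltnP k w); lia.
- move=> k kn; case: (ltngtP k v); case: (ltnP k u); case: (ltnP k w); lia.
- move=> k l kn ln; case: (ltngtP k v); case: (ltnP k w);
    case: (ltngtP l v); case: (ltnP l w); lia.
- move=> k l kn ln; case: (ltnP k u); case: (ltnP k v); case: (ltnP k w);
    case: (ltnP l u); case: (ltnP l v); case: (ltnP l w); lia.
- move=> k l kn ln; case: (ltngtP k v); case: (ltnP k w);
    case: (ltnP l u); case: (ltnP l v); case: (ltnP l w); lia.
Qed.

Lemma realizes_arcs n op cl p (arc : nat -> nat -> bool) :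
  realizes n op cl p -> (forall k, k < n -> arc (op k) (cl k)) ->
  forall x, x < n.*2 -> x < p x -> arc x (p x).
Proof.
move=> re arcP x xN xp; have [k kn E] := realizes_opener re xN xp.
by rewrite E (realizes_arc re kn); apply: arcP.
Qed.

Lemma stoimenow_of_arcs N p (arc : nat -> nat -> bool) :
  matching_involution N p -> (forall x, x < N -> x < p x -> arc x (p x)) ->
  (forall x y z, arc x y -> arc x.+1 z -> y < z) ->
  (forall x y z, arc x z -> arc y z.+1 -> x < y) ->
  stoimenow_involution N p.
Proof.
move=> inv arcP opP clP; split=> // x xN.
- by move=> xp xp1; apply: (opP x); apply: arcP => //; apply: ltnW.
- move=> xp xp1; apply: (clP _ _ x).
    have xN' := ltnW xN; have := @arcP (p x).
    by rewrite (invol_sym inv xN' erefl); apply=> //; apply: ltn_trans xN'.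
  have := @arcP (p x.+1).
  by rewrite (invol_sym inv xN erefl); apply=> //; apply: ltn_trans xN.
Qed.

(** Eight increasing integers subject to four linear arc conditions: for a
concrete Q the remaining hypothesis is a statement of linear arithmetic. *)
Lemma avoiding_of_arcs N p (arc : nat -> nat -> bool) Q :
  (forall x, x < N -> x < p x -> arc x (p x)) ->
  all (fun ab => [&& 0 < ab.1, ab.1 < ab.2 & ab.2 <= 8]) Q ->
  (forall xs, size xs = 8 -> sorted ltn xs ->
     ~~ all (fun ab => arc (nth 0 xs ab.1.-1) (nth 0 xs ab.2.-1)) Q) ->
  avoiding N p Q.
Proof.
move=> arcP /allP ordQ noarc xs; apply/negP => /and4P[/eqP sz srt ltN pQ].
have /negP[] := noarc xs sz srt; apply/allP => ab Qab.
have /eqP E := allP pQ _ Qab; have := ordQ _ Qab; move=> /and3P[ab1 ab12 ab2].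
have xi i : i < 8 -> nth 0 xs i < N by rewrite -sz => /mem_nth/(allP ltN).
rewrite -E; apply: arcP; first by apply: xi; lia.
by rewrite E; apply: (sorted_ltn_nth ltn_trans) => //; rewrite ?inE ?sz; lia.
Qed.

Ltac solve_pattern defs :=
  case=> [|x1 [|x2 [|x3 [|x4 [|x5 [|x6 [|x7 [|x8 [|? ?]]]]]]]]] //= _;
  defs; lia.

Lemma span_sound n u v w p : valid n u v w ->
  realizes n (span_op u v w) (span_cl n u v w) p ->
  stoimenow_involution n.*2 p /\
  {in [:: pattern2; pattern3; pattern4; pattern5], forall Q, avoiding n.*2 p Q}.
Proof.
move=> val re; have arcP := realizes_arcs re (fun k => span_arcP val (k := k)).
move: val; rewrite /valid => val; split.
  apply: (stoimenow_of_arcs re arcP) => x y z; rewrite /span_arc; lia.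
move=> Q; rewrite !inE => /or4P[] /eqP->; apply: (avoiding_of_arcs arcP) => //;
    solve_pattern ltac:(rewrite /span_arc).
Qed.

Lemma cross_sound n u v w p : valid n u v w ->
  realizes n (cross_op u v w) (cross_cl n u v w) p ->
  stoimenow_involution n.*2 p /\
  {in [:: pattern1; pattern2; pattern3; pattern4], forall Q, avoiding n.*2 p Q}.
Proof.
move=> val re; have arcP := realizes_arcs re (fun k => cross_arcP val (k := k)).
move: val; rewrite /valid => val; split.
  apply: (stoimenow_of_arcs re arcP) => x y z; rewrite /cross_arc /span_arc;
    by case: eqP => vw; lia.
move=> Q; rewrite !inE => /or4P[] /eqP->; apply: (avoiding_of_arcs arcP) => //;
  by solve_pattern ltac:(rewrite /cross_arc /span_arc; case: eqP => vw).
Qed.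

(** * Every avoiding matching belongs to its family *)

(** If every middle arc joins adjacent points, no opening arc is closed after
the first opener s + u behind s, so that only the numbers u, s, m and n remain
free. *)
Lemma spanning_shape n p : stoimenow_involution n.*2 p ->
  p 0 < p n.*2.-1 -> avoiding n.*2 p pattern2 ->
  (forall i, p 0 < i -> i < p i -> p i < p n.*2.-1 -> p i = i.+1) ->
  exists u v w, [/\ 0 < u, u <= v, v <= w, w < n
    & forall k, k < n -> p (span_op u v w k) = span_cl n u v w k].
Proof.
move=> st; move pe : (p n.*2.-1) => e; move ps : (p 0) => s => lt_se av2 adj.
have [s0 eN p_s p_e] := ends_bounds st ps pe lt_se.
have [u [/andP[u0 us] te tp p_first p_firstV]] :=
  first_middle_opener st ps pe lt_se.
have noF x : s + u <= x -> x < e -> s <= p x.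
  apply: (no_opening_closer_after st ps pe lt_se av2); [lia | lia |].
  move=> i ti ip pie; have pi := adj i; rewrite -pi; [|lia..].
  have iN : i < n.*2 by lia.
  by rewrite (invol_sym st iN erefl); lia.
have inside i q : s < i -> i < q -> q < p i -> p i < e -> p q < s.
  by move=> si iq qp pie; have := adj i; lia.
have [|||m [me p_single p_closing]] :=
  tail_shape st ps pe lt_se (t := s + u) av2 inside; [lia | lia | |].
  move=> x tx xe; have := noF x; have := p_firstV (p x).
  have xN : x < n.*2 by lia.
  rewrite (invol_sym st xN erefl).
  have [->|] : x = e \/ x < e by lia.
    by rewrite p_e; lia.
  by have := @invol_sym _ _ st x s; lia.
have [||||||N_eq p_long p_close] :=
  @outer_shape _ p s e st ps pe lt_se (s + u + m.*2) u.
- by lia.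
- by lia.
- by lia.
- move=> x sx xq; have := p_firstV x; have [xt|tx] := ltnP x (s + u); first by lia.
  by move=> _; right; have := adjacent_pairs st _ p_single (x := x); lia.
- by move=> x ux; have := p_first x; lia.
- by [].
exists u, s, (s + m); split; [lia..|] => k kn.
rewrite /span_op /span_cl.
case: (ltnP k u) => ku; first by rewrite ifT ?p_first; lia.
case: (ltnP k s) => ks.
  by have := p_long (k - u); rewrite subnKC; lia.
case: (ltnP k (s + m)) => km.
  have := p_single (k - s).
  by rewrite (_ : s + u + (k - s).*2 = u + k.*2 - s); lia.
have := p_close (k - (s + m)).
by rewrite (_ : s + u + m.*2 + (k - (s + m)) = u + (s + m) - s + k); lia.
Qed.

(** In the presence of a middle arc, P1 excludes long arcs, hence every arc of
the first run is an opening one.  The first opener s + u behind s starts a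
middle arc, since after a closing arc only closing arcs open; by P1 no later
middle arc is crossed, so all the opening arcs not closed before s + u are
closed inside this one, and the rest is as in the spanning case. *)
Lemma crossing_shape n p i : stoimenow_involution n.*2 p ->
  p 0 < p n.*2.-1 ->
  avoiding n.*2 p pattern1 -> avoiding n.*2 p pattern2 ->
  avoiding n.*2 p pattern3 -> avoiding n.*2 p pattern4 ->
  p 0 < i -> i < p i -> p i < p n.*2.-1 ->
  exists u v w, [/\ 0 < u, u <= v, v < w, w < n
    & forall k, k < n -> p (cross_op u v w k) = cross_cl n u v w k].
Proof.
move=> st; move pe : (p n.*2.-1) => e; move ps : (p 0) => s => lt_se.
move=> av1 av2 av3 av4 si ipi pie.
have [s0 eN p_s p_e] := ends_bounds st ps pe lt_se.
have [u [/andP[u0 us] te tp p_first p_firstV]] :=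
  first_middle_opener st ps pe lt_se.
have inside j q : s < j -> j < q -> q < p j -> p j < e -> p q < s.
  by apply: (inside_middle st ps pe lt_se).
have [l pt] : exists l, p (s + u) = l by exists (p (s + u)).
have tN : s + u < n.*2 by lia.
have p_l := invol_sym st tN pt.
have le : l < e.
  (* Otherwise only closing arcs open from s + u on, and i does not. *)
  have ti : s + u <= i by have := p_firstV i; lia.
  have run := closing_run st ps pe lt_se (x := s + u) (y := i) av2 inside.
  rewrite ltnNge; apply/negP => el.
  have [E|E] : e = l \/ e < l by lia.
    by move: p_l; rewrite -E p_e; lia.
  by move: run; rewrite pt; lia.
rewrite pt in tp.
have between q : s + u < q -> q < l -> p q < s.
  by move=> tq ql; apply: (inside (s + u)); rewrite ?pt; lia.
have noF x : l <= x -> x < e -> s <= p x.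
  apply: (no_opening_closer_after st ps pe lt_se av2); [lia | lia |].
  move=> j lj jp pje; rewrite leqNgt; apply/negP => pj1.
  have jN : j < n.*2 by lia.
  have [E|E] : p j = j.+1 \/ j.+1 < p j by lia.
    by have := invol_sym st jN E; lia.
  have [E'|E'] : j = l \/ l < j by lia.
    by move: jp; rewrite E' p_l; lia.
  have := crossing_meets_first_middle st ps pe lt_se
    (z := j.+1) (i := s + u) (j := j) av1.
  by rewrite pt; lia.
have later x : l < x -> x <= e -> l < p x.
  move=> lx xe; have xN : x < n.*2 by lia.
  have [->|xe'] : x = e \/ x < e by lia.
    by rewrite p_e; lia.
  have p_px := invol_sym st xN erefl.
  have := noF x; have := p_firstV (p x); have := between (p x); rewrite p_px.
  have neq_t : p x != s + u by apply/eqP => E; move: p_px; rewrite E pt; lia.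
  have neq_l : p x != l by apply/eqP => E; move: p_px; rewrite E p_l; lia.
  by lia.
have [|||m [me p_single p_closing]] :=
  tail_shape st ps pe lt_se (t := l.+1) av2 inside; [lia | lia | done |].
have [||||||N_eq _ p_close] :=
  @outer_shape _ p s e st ps pe lt_se (l.+1 + m.*2) s.
- by lia.
- by lia.
- by lia.
- move=> x sx xq; have := p_firstV x; have := between x.
  have [->|xt] := eqVneq x (s + u); first by rewrite pt; lia.
  have [->|xl] := eqVneq x l; first by rewrite p_l; lia.
  have [lx|] := ltnP l x; last by lia.
  move=> _ _; right.
  by have := adjacent_pairs st _ p_single (x := x); lia.
- move=> x xs; have xN : x < n.*2 by lia.
  have p_px := invol_sym st xN erefl.
  have := long_excludes_middle st ps pe lt_se (f := x) (i := s + u) av1.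
  by have := p_closing (p x); rewrite p_px pt; lia.
- by [].
rewrite subnn addn0 in N_eq p_close.
have incF x : u <= x -> x.+1 < u + (s - u) -> p x < p x.+1.
  by move=> _ lx; apply: (first_run_increasing st); lia.
have incC x : (s + u).+1 <= x -> x.+1 < (s + u).+1 + (l - (s + u).+1) ->
    p x < p x.+1.
  move=> tx xl; have := between x; have := between x.+1.
  by have := closers_increasing st (x := x); lia.
have imC x : (s + u).+1 <= x -> x < (s + u).+1 + (l - (s + u).+1) ->
    u <= p x < u + (s - u).
  move=> tx xl; have := between x; have := p_first (p x).
  have xN : x < n.*2 by lia.
  by rewrite (invol_sym st xN erefl); lia.
have imF x : u <= x -> x < u + (s - u) ->
    (s + u).+1 <= p x < (s + u).+1 + (l - (s + u).+1).
  move=> ux xs; have xN : x < n.*2 by lia.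
  have p_px := invol_sym st xN erefl.
  have neq_t : p x != s + u by apply/eqP => E; move: p_px; rewrite E pt; lia.
  have neq_l : p x != l by apply/eqP => E; move: p_px; rewrite E p_l; lia.
  have := long_excludes_middle st ps pe lt_se (f := x) (i := s + u) av1.
  have := p_firstV (p x); have := later (p x).
  by have := @first_ge _ _ _ _ st ps pe lt_se x; rewrite p_px pt; lia.
have := increasing_size incF imF; have := increasing_size incC imC => le1 le2.
have size_eq : l - (s + u).+1 = s - u by lia.
have p_long i' : i' < s - u -> p (u + i') = (s + u).+1 + i'.
  apply: (increasing_shift incF) => x ux xs; have := imF x ux xs; lia.
exists u, s, (s + m).+1; split; [lia..|] => k kn.
rewrite /cross_op /cross_cl (_ : (s == (s + m).+1) = false); last by lia.
case: (ltnP k u) => ku; first by rewrite ifT ?p_first; lia.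
case: (ltnP k s) => ks; first by have := p_long (k - u); rewrite subnKC; lia.
have [ks'|ks'] := eqVneq k s; first by rewrite ks' pt ifT; lia.
case: (ltnP k (s + m).+1) => km.
  have := p_single (k - s.+1).
  by rewrite (_ : l.+1 + (k - s.+1).*2 = k.*2); lia.
have := p_close (k - (s + m).+1).
by rewrite (_ : l.+1 + m.*2 + (k - (s + m).+1) = (s + m).+1 + k); lia.
Qed.

Lemma ends_cases n p : stoimenow_involution n.*2 p ->
  (forall k, k < n -> p k = n + k) \/ p 0 < p n.*2.-1.
Proof.
move=> st; case: (posnP n) => [->|n0]; first by left.
have N0 : 0 < n.*2 by lia.
case: (ltngtP (p 0) (p n.*2.-1)) => [|gt|eq]; [by right| |].
  by left; apply: antichain_shape.
have := invol_sym st N0 eq; have N1 : n.*2.-1 < n.*2 by lia.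
by rewrite (invol_sym st N1 erefl); lia.
Qed.

Lemma span_complete n p : stoimenow_involution n.*2 p ->
  {in [:: pattern2; pattern3; pattern4; pattern5],
    forall Q, avoiding n.*2 p Q} ->
  exists u v w, valid n u v w /\
    forall k, k < n -> p (span_op u v w k) = span_cl n u v w k.
Proof.
move=> st av; have [anti|lt_ends] := ends_cases st.
  exists n, n, n; split; first by rewrite /valid; lia.
  by move=> k kn; rewrite /span_op /span_cl kn anti.
have av2 : avoiding n.*2 p pattern2 by apply: av; rewrite !inE eqxx.
have av3 : avoiding n.*2 p pattern3 by apply: av; rewrite !inE eqxx ?orbT.
have av4 : avoiding n.*2 p pattern4 by apply: av; rewrite !inE eqxx ?orbT.
have av5 : avoiding n.*2 p pattern5 by apply: av; rewrite !inE eqxx ?orbT.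
have [|u [v [w [u0 uv vw wn arcs]]]] := spanning_shape st lt_ends av2.
  move=> i si ipi pie; have [//|lt_i] : p i = i.+1 \/ i.+1 < p i by lia.
  have := inside_middle st erefl erefl lt_ends (i := i) (q := i.+1) av3 av4.
  have := opening_middle_noncrossing st erefl erefl lt_ends
    (i := i) (z := i.+1) av5.
  lia.
by exists u, v, w; split => //; rewrite /valid; lia.
Qed.

Lemma cross_complete n p : stoimenow_involution n.*2 p ->
  {in [:: pattern1; pattern2; pattern3; pattern4],
    forall Q, avoiding n.*2 p Q} ->
  exists u v w, valid n u v w /\
    forall k, k < n -> p (cross_op u v w k) = cross_cl n u v w k.
Proof.
move=> st av; have [anti|lt_ends] := ends_cases st.
  exists n, n, n; split; first by rewrite /valid; lia.
  by move=> k kn; rewrite /cross_op /cross_cl eqxx /span_op /span_cl kn anti.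
have av1 : avoiding n.*2 p pattern1 by apply: av; rewrite !inE eqxx.
have av2 : avoiding n.*2 p pattern2 by apply: av; rewrite !inE eqxx ?orbT.
have av3 : avoiding n.*2 p pattern3 by apply: av; rewrite !inE eqxx ?orbT.
have av4 : avoiding n.*2 p pattern4 by apply: av; rewrite !inE eqxx ?orbT.
have [/hasP[i _ /and3P[si ipi pie]]|/hasPn none] := boolP (has
  (fun i => [&& p 0 < i, i < p i & p i < p n.*2.-1]) (iota 0 n.*2)).
  have [u [v [w [u0 uv vw wn arcs]]]] :=
    crossing_shape st lt_ends av1 av2 av3 av4 si ipi pie.
  by exists u, v, w; split => //; rewrite /valid; lia.
have noM i : p 0 < i -> i < p i -> p i < p n.*2.-1 -> False.
  move=> si ipi pie.
  have n0 : 0 < n by case: posnP lt_ends => // ->; rewrite ltnn.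
  have N1 : n.*2.-1 < n.*2 by lia.
  have := invol_lt st N1; have := none i; rewrite mem_iota si ipi pie; lia.
have [|u [v [w [u0 uv vw wn arcs]]]] := spanning_shape st lt_ends av2.
  by move=> i si ipi pie; case: (noM i).
exists u, v, w; split; first by rewrite /valid; lia.
(* For v < w the arc number v would be a middle arc. *)
have eq_vw : v = w.
  apply/eqP; rewrite eqn_leq vw leqNgt; apply/negP => lt_vw.
  have E0 : p 0 = v.
    by have := arcs 0; rewrite /span_op /span_cl u0 (leq_trans u0 uv) addn0; lia.
  have Ee : p n.*2.-1 = u + w - v + n.-1.
    have n1 : n.-1 < n by lia.
    have := arcs _ n1; rewrite /span_op /span_cl !ifF; [|lia..].
    move=> E; rewrite (_ : n.*2.-1 = n + n.-1); last by lia.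
    by apply: (invol_sym st) E; lia.
  have := arcs v; rewrite /span_op /span_cl ltnn lt_vw ifF; last by lia.
  by have := noM (u + v.*2 - v); rewrite E0 Ee; lia.
by rewrite /cross_op /cross_cl eq_vw eqxx -eq_vw in arcs *.
Qed.

(** * The parameters are determined by the matching *)

Lemma realizes_arcs_all n op cl p (arc : nat -> nat -> bool) :
  realizes n op cl p -> (forall k, k < n -> arc (op k) (cl k)) ->
  forall x, x < n.*2 -> (x < p x) && arc x (p x) || (p x < x) && arc (p x) x.
Proof.
move=> re arcP x xN; have inv : matching_involution n.*2 p := re.
have neq := invol_neq inv xN; have ppx := invol_sym inv xN erefl.
have arcX := realizes_arcs re arcP xN.
have := realizes_arcs re arcP (invol_lt inv xN); rewrite ppx.
lia.
Qed.

Lemma span_inj n u v w u' v' w' p : valid n u v w -> valid n u' v' w' ->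
  realizes n (span_op u v w) (span_cl n u v w) p ->
  realizes n (span_op u' v' w') (span_cl n u' v' w') p ->
  [/\ u = u', v = v' & w = w'].
Proof.
move=> val val' re re'.
have := realizes_arcs_all re (fun k => span_arcP val (k := k)).
have := realizes_arcs_all re' (fun k => span_arcP val' (k := k)).
move: val val'; rewrite /valid /span_arc => val val' arc' arc.
have [n0|n0] := posnP n; first by split; lia.
have N0 : 0 < n.*2 by lia.
have N1 : n.*2.-1 < n.*2 by lia.
have eq_v : v = v' by have := arc _ N0; have := arc' _ N0; lia.
have eq_uw : u + w = u' + w'.
  by have := arc _ N1; have := arc' _ N1; lia.
have le_u : u' <= u by have := arc u; have := arc' u; lia.
have le_u' : u <= u' by have := arc u'; have := arc' u'; lia.
split; lia.
Qed.

Lemma realizes_start n u v w p : valid n u v w -> 0 < n ->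
  realizes n (cross_op u v w) (cross_cl n u v w) p -> p 0 = v.
Proof.
move=> val n0 re; have := realizes_arc re n0.
move: val; rewrite /valid /cross_op /cross_cl /span_op /span_cl => val.
have [u0 v0] : 0 < u /\ 0 < v by lia.
by rewrite u0 v0 !addn0; case: eqP; lia.
Qed.

(** The parameters can be read off the first closer v, the last opener, and
the length u of the initial segment on which p is the translation by v. *)
Lemma realizes_ends n u v w p : valid n u v w -> v < n ->
  realizes n (cross_op u v w) (cross_cl n u v w) p ->
  p n.*2.-1 = (if v == w then u else w) + n.-1 /\
  forall x, x < v -> (p x == v + x) = (x < u).
Proof.
move=> val vn re; have := realizes_arcs_all re (fun k => cross_arcP val (k := k)).
move: val; rewrite /valid /cross_arc /span_arc => val arc.
have N1 : n.*2.-1 < n.*2 by lia.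
case: (eqVneq v w) arc => vw arc; split=> [|x xv].
- by have := arc _ N1; lia.
- by have := arc x; lia.
- by have := arc _ N1; lia.
- by have := arc x; lia.
Qed.

Lemma cross_inj n u v w u' v' w' p : valid n u v w -> valid n u' v' w' ->
  realizes n (cross_op u v w) (cross_cl n u v w) p ->
  realizes n (cross_op u' v' w') (cross_cl n u' v' w') p ->
  [/\ u = u', v = v' & w = w'].
Proof.
move=> val val' re re'; case: (posnP n) => [n0|n0].
  by move: val val'; rewrite n0 /valid; split; lia.
have eq_v : v = v'.
  by rewrite -(realizes_start val n0 re) (realizes_start val' n0 re').
subst v'; case: (ltnP v n) => vn; last first.
  by move: val val'; rewrite /valid; split; lia.
have [pN pF] := realizes_ends val vn re.
have [pN' pF'] := realizes_ends val' vn re'.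
have eq_u : u = u'.
  move: val val'; rewrite /valid => val val'.
  have := pF u; have := pF u'; have := pF' u; have := pF' u'; lia.
move: val val'; rewrite /valid => val val'; split=> //.
by move: pN; rewrite pN'; case: eqP; case: eqP; lia.
Qed.

Lemma span_parametrizes n : parametrizes n
  [:: pattern2; pattern3; pattern4; pattern5] span_op (span_cl n).
Proof.
split; [exact: span_system | exact: span_sound |
        exact: span_complete | exact: span_inj].
Qed.

Lemma cross_parametrizes n : parametrizes n
  [:: pattern1; pattern2; pattern3; pattern4] cross_op (cross_cl n).
Proof.
split; [exact: cross_system | exact: cross_sound |
        exact: cross_complete | exact: cross_inj].
Qed.

(** * Reversal *)

Lemma flipK N p x : matching_involution N p -> x < N -> flip N (flip N p) x = p x.
Proof.
move=> inv xN; have := invol_lt inv xN.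
by rewrite /flip (_ : N.-1 - (N.-1 - x) = x); lia.
Qed.

Lemma eq_stoimenow N p q : (forall x, x < N -> p x = q x) ->
  stoimenow_involution N p -> stoimenow_involution N q.
Proof.
move=> eq_pq [[plt pne psym] pop pcl]; split; first split.
- by move=> x xN; rewrite -eq_pq ?plt.
- by move=> x xN; rewrite -eq_pq ?pne.
- by move=> x y xN; rewrite -eq_pq // => E; rewrite -eq_pq ?(psym x y) // -E plt.
- by move=> x xN; have := ltnW xN => xN'; rewrite -!eq_pq //; apply: pop.
- by move=> x xN; have := ltnW xN => xN'; rewrite -!eq_pq //; apply: pcl.
Qed.

(** Labels run from 1 to 8, so the mirror image of the label a is 9 - a. *)
Definition flip_pattern (Q : seq (nat * nat)) :=
  [seq (9 - ab.2, 9 - ab.1) | ab <- Q].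

Lemma flip_patternK Q : wf_pattern Q -> flip_pattern (flip_pattern Q) = Q.
Proof.
move=> /and3P[/allP ordQ _ _]; rewrite /flip_pattern -map_comp map_id_in // => ab.
by case: ab => a b /ordQ /= /and3P[? ? ?]; congr (_, _); lia.
Qed.

Lemma flip_wf Q : wf_pattern Q -> wf_pattern (flip_pattern Q).
Proof.
move=> /and3P[/allP ordQ uQ sQ]; rewrite /wf_pattern size_map sQ andbT.
apply/andP; split.
  apply/allP => _ /mapP[[a b] /ordQ /= /and3P[? ? ?] ->] /=; lia.
rewrite map_inj_in_uniq // => -[a b] [c d] /ordQ /= /and3P[? ? ?].
by move=> /ordQ /= /and3P[? ? ?] [? ?]; congr (_, _); lia.
Qed.

(** Reversing the positions of an occurrence in p gives an occurrence of the
mirror image in the reversed matching. *)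
Lemma flip_avoiding N p Q : matching_involution N p -> wf_pattern Q ->
  avoiding N (flip N p) Q -> avoiding N p (flip_pattern Q).
Proof.
move=> inv /and3P[/allP ordQ _ _] av xs; apply/negP => /and4P[/eqP sz srt lt pQ].
have /negP[] := av (rev [seq N.-1 - x | x <- xs]).
have nthE i : i < 8 -> nth 0 (rev [seq N.-1 - x | x <- xs]) i =
    N.-1 - nth 0 xs (7 - i).
  move=> i8; rewrite nth_rev size_map sz // (nth_map 0) ?sz //; lia.
have xlt i : i < 8 -> nth 0 xs i < N by rewrite -sz => /mem_nth/(allP lt).
apply/and4P; split.
- by rewrite size_rev size_map sz.
- rewrite rev_sorted sorted_map.
  apply: (sub_in_sorted (P := fun x => x < N) _ lt srt) => x y.
  by rewrite !unfold_in /=; lia.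
- by rewrite all_rev; apply/allP => _ /mapP[x /(allP lt) xN ->]; lia.
- apply/allP => -[a b] Qab /=; have /and3P[/= a1 ab b8] := ordQ _ Qab.
  have Qf : (9 - b, 9 - a) \in flip_pattern Q by apply/mapP; exists (a, b).
  have /eqP E := allP pQ _ Qf; rewrite /= in E.
  rewrite !nthE; [|lia..].
  have lt1 := xlt (7 - a.-1); have lt2 := xlt (7 - b.-1).
  rewrite (_ : (9 - b).-1 = 7 - b.-1) in E; last by lia.
  rewrite (_ : (9 - a).-1 = 7 - a.-1) in E; last by lia.
  have lt2' : nth 0 xs (7 - b.-1) < N by apply: lt2; lia.
  have := invol_sym inv lt2' E; rewrite /flip subKn => [->//|]; lia.
Qed.

Lemma eq_avoiding N p q Q : (forall x, x < N -> p x = q x) -> wf_pattern Q ->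
  avoiding N p Q -> avoiding N q Q.
Proof.
move=> eq_pq /and3P[/allP ordQ _ _] av xs; apply/negP => /and4P[/eqP sz srt lt pQ].
have /negP[] := av xs; apply/and4P; split=> //; first by rewrite sz.
apply/allP => ab Qab; rewrite eq_pq; first exact: (allP pQ).
by apply: (allP lt); apply: mem_nth; rewrite sz; have := ordQ _ Qab; lia.
Qed.

Definition flip_arc n (f : nat -> nat -> nat -> nat -> nat) u v w k :=
  n.*2.-1 - f u v w k.

Lemma flip_realizes n op cl p : arc_system n op cl ->
  realizes n (fun k => n.*2.-1 - cl k) (fun k => n.*2.-1 - op k) p ->
  realizes n op cl (flip n.*2 p).
Proof.
move=> sys [inv arc open]; split; first exact: flip_matching.
- move=> k kn; have := arc k kn; have := arc_ordered sys kn.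
  have := arc_bounded sys kn => clN oc E.
  have xN : n.*2.-1 - cl k < n.*2 by lia.
  by have := invol_sym inv xN E; rewrite /flip => ->; lia.
- move=> x xN xp; set y := n.*2.-1 - x.
  have yN : y < n.*2 by rewrite /y; lia.
  have pyN := invol_lt inv yN; have ppy := invol_sym inv yN erefl.
  have [|k kn E] := open _ pyN; first by rewrite ppy; move: xp; rewrite /flip -/y; lia.
  exists k => //; have := arc k kn; rewrite -E ppy /y.
  by have := arc_ordered sys kn; have := arc_bounded sys kn; lia.
Qed.

(** Reversal exchanges openers and closers, so the two arc functions swap. *)
Lemma flip_parametrizes n Qs op cl : all wf_pattern Qs -> parametrizes n Qs op cl ->
  parametrizes n (map flip_pattern Qs) (flip_arc n cl) (flip_arc n op).
Proof.
move=> /allP wfQ [sys sound complete inj]; split.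
- move=> u v w val; have [oc cN oinj cinj onc] := sys _ _ _ val.
  have oN k : k < n -> op u v w k < n.*2.
    by move=> kn; exact: ltn_trans (oc k kn) (cN k kn).
  rewrite /flip_arc; split.
  + by move=> k kn; have := oc k kn; have := cN k kn; lia.
  + by move=> k kn; have := oc k kn; have := cN k kn; lia.
  + move=> k l kn ln E; apply: cinj => //.
    by have := cN k kn; have := cN l ln; lia.
  + move=> k l kn ln E; apply: oinj => //.
    by have := oN k kn; have := oN l ln; lia.
  + move=> k l kn ln; have := onc l k ln kn.
    by have := cN k kn; have := oN l ln; lia.
- move=> u v w p val re; have re' := flip_realizes (sys _ _ _ val) re.
  have [st av] := sound _ _ _ _ val re'.
  have inv : matching_involution n.*2 p := re; split.
    by apply: (eq_stoimenow _ (flip_stoimenow st)) => x; apply: flipK.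
  by move=> _ /mapP[Q QQs ->]; apply: flip_avoiding; [| apply: wfQ | apply: av].
- move=> p st av; have [|u [v [w [val arc]]]] := complete _ (flip_stoimenow st).
    move=> Q QQs; rewrite -(flip_patternK (wfQ Q QQs)).
    apply: flip_avoiding; [exact: (flip_matching st) | exact/flip_wf/wfQ |].
    apply: eq_avoiding (av _ (map_f _ QQs)); last exact/flip_wf/wfQ.
    by move=> x xN; rewrite (flipK st xN).
  exists u, v, w; split=> // k kn; have := arc k kn; rewrite /flip /flip_arc.
  have [oc cN _ _ _] := sys _ _ _ val.
  have ocs := oc k kn; have cNs := cN k kn.
  have oN : n.*2.-1 - op u v w k < n.*2 by lia.
  move=> E; apply: (invol_sym st oN); have := invol_lt st oN; lia.
- move=> u v w u' v' w' p val val' re re'; apply: (inj _ _ _ _ _ _ _ val val').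
    exact: (flip_realizes (sys _ _ _ val) re).
  exact: (flip_realizes (sys _ _ _ val') re').
Qed.

(** * From sets of arcs to involutions *)

(** The values x and i in the two failing cases are defaults: in a matching every
point has a partner. *)
Definition partner n (M : {set {set 'I_n.*2}}) (x : nat) : nat :=
  if insub x is Some i
  then odflt i [pick j | (j != i) && ([set i; j] \in M)] else x.

Lemma matching_block n (M : {set {set 'I_n.*2}}) i : is_matching M ->
  exists j, j != i /\ [set i; j] \in M.
Proof.
move=> /andP[/and3P[/eqP cov _ _] /forall_inP blk].
have : i \in cover M by rewrite cov inE.
case/bigcupP => B BM iB; have /cards2P[x [y [xy E]]] := blk _ BM.
move: iB; rewrite E !inE => /orP[] /eqP->.
- by exists y; rewrite eq_sym -E.
- by exists x; rewrite xy setUC -E.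
Qed.

Lemma matching_unique n (M : {set {set 'I_n.*2}}) i j k : is_matching M ->
  [set i; j] \in M -> j != i -> [set i; k] \in M -> j = k.
Proof.
move=> /andP[/and3P[_ /trivIsetP triv _] _] ijM ji ikM.
have [E|neq] := eqVneq [set i; j] [set i; k].
  have : j \in [set i; k] by rewrite -E !inE eqxx orbT.
  by rewrite !inE (negPf ji) => /eqP.
have /pred0P/(_ i) := triv _ _ ijM ikM neq.
by rewrite !inE eqxx.
Qed.

Lemma partner_eq n (M : {set {set 'I_n.*2}}) (i j : 'I_n.*2) : is_matching M ->
  j != i -> (partner M i == j) = ([set i; j] \in M).
Proof.
move=> mat ji; rewrite /partner valK.
case: pickP => [k /andP[ki ikM]|none] /=.
  apply/eqP/idP => [/val_inj <-//|ijM].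
  by rewrite (matching_unique mat ikM ki ijM).
by have [k [ki ikM]] := matching_block i mat; have := none k; rewrite ki ikM.
Qed.

Lemma partner_ord n (M : {set {set 'I_n.*2}}) (i : 'I_n.*2) : is_matching M ->
  exists2 j : 'I_n.*2, j != i & partner M i = j.
Proof.
move=> mat; have [j [ji ijM]] := matching_block i mat.
by exists j => //; apply/eqP; rewrite partner_eq.
Qed.

Lemma partner_matching n (M : {set {set 'I_n.*2}}) : is_matching M ->
  matching_involution n.*2 (partner M).
Proof.
move=> mat; split=> [x xN|x xN|x y xN].
- by have [j _ ->] := partner_ord (Ordinal xN) mat.
- by have [j ji ->] := partner_ord (Ordinal xN) mat.
- have [j ji pj] := partner_ord (Ordinal xN) mat; rewrite pj => <-.
  apply/eqP; rewrite (partner_eq (j := Ordinal xN)) 1?eq_sym //.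
  by rewrite setUC -partner_eq // pj.
Qed.

Lemma is_arcE n (M : {set {set 'I_n.*2}}) (i j : 'I_n.*2) : is_matching M ->
  is_arc M i j = (i < j) && (partner M i == j).
Proof.
move=> mat; rewrite /is_arc; case: ltnP => // ij; rewrite partner_eq //.
by rewrite -val_eqE /= neq_ltn ij orbT.
Qed.

Lemma partner_stoimenow n (M : {set {set 'I_n.*2}}) : is_matching M ->
  is_stoimenow M <-> stoimenow_involution n.*2 (partner M).
Proof.
move=> mat; have inv := partner_matching mat; rewrite /is_stoimenow mat /=.
split=> [/andP[noT1 noT2]|st].
- split=> // x xN.
  + move=> xp xp1; have xN' := ltnW xN; rewrite ltnNge; apply/negP => le.
    have pN := invol_lt inv xN'; have p1N := invol_lt inv xN.
    have ppx := invol_sym inv xN' erefl.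
    have neq : partner M x != partner M x.+1.
      by apply/eqP => E; move: (invol_sym inv xN (esym E)); rewrite ppx; lia.
    case/negP: noT1; apply/existsP; exists (Ordinal xN').
    apply/existsP; exists (Ordinal xN); apply/existsP; exists (Ordinal p1N).
    apply/existsP; exists (Ordinal pN).
    by rewrite !is_arcE //= !eqxx xp xp1 /=; lia.
  + move=> xp xp1; have xN' := ltnW xN; rewrite ltnNge; apply/negP => le.
    have pN := invol_lt inv xN'; have p1N := invol_lt inv xN.
    have ppx := invol_sym inv xN' erefl; have ppx1 := invol_sym inv xN erefl.
    have neq : partner M x != partner M x.+1.
      by apply/eqP => E; move: ppx1; rewrite -E ppx; lia.
    case/negP: noT2; apply/existsP; exists (Ordinal xN').
    apply/existsP; exists (Ordinal xN); apply/existsP; exists (Ordinal p1N).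
    apply/existsP; exists (Ordinal pN).
    by rewrite !is_arcE //= ppx ppx1 !eqxx xp xp1 /=; lia.
- apply/andP; split; apply/negP.
  + case/existsP => i /existsP[i' /existsP[k /existsP[l /and5P[/eqP ii' i'k kl]]]].
    rewrite !is_arcE // => /andP[il /eqP pi] /andP[_ /eqP pi'].
    have := openers_increasing st (x := i); rewrite -ii' pi pi'.
    by have := ltn_ord i'; lia.
  + case/existsP => j /existsP[j' /existsP[k /existsP[l /and5P[/eqP jj' kl lj]]]].
    rewrite !is_arcE // => /andP[kj' /eqP pk] /andP[_ /eqP pl].
    have := closers_increasing st (x := j); rewrite -jj'.
    rewrite (invol_sym inv _ pk) // (invol_sym inv _ pl) //.
    by have := ltn_ord j'; lia.
Qed.

Definition pattern_set (Q : seq (nat * nat)) : {set {set 'I_4.*2}} :=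
  [set:: [seq arc8 ab.1 ab.2 | ab <- Q]].

Lemma arc8_inj Q : wf_pattern Q ->
  {in Q &, injective (fun ab => arc8 ab.1 ab.2)}.
Proof.
move=> /and3P[/allP ordQ _ _] [a b] [c d] /ordQ /= /and3P[? ? ?].
move=> /ordQ /= /and3P[? ? ?] /setP E.
have := E (inord a.-1); have := E (inord b.-1); have := E (inord c.-1).
rewrite /arc8 !inE -!val_eqE /= !inordK; [|lia..].
by move=> *; congr (_, _); lia.
Qed.

Lemma card_pattern_set Q : wf_pattern Q -> #|pattern_set Q| = 4.
Proof.
move=> wf; have /and3P[_ uQ /eqP sQ] := wf; rewrite cardsE.
have /card_uniqP-> : uniq [seq arc8 ab.1 ab.2 | ab <- Q].
  by rewrite map_inj_in_uniq //; apply: arc8_inj.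
by rewrite size_map.
Qed.

Lemma avoids_pattern n (M : {set {set 'I_n.*2}}) Q : is_matching M ->
  wf_pattern Q -> avoids M (pattern_set Q) <-> avoiding n.*2 (partner M) Q.
Proof.
move=> mat wf; have /and3P[/allP ordQ _ _] := wf; split.
- move=> av xs; apply/negP => /and4P[/eqP sz srt /allP lt /allP pQ].
  have xN (i : 'I_8) : nth 0 xs i < n.*2 by apply: lt; rewrite mem_nth ?sz.
  pose f : {ffun 'I_4.*2 -> 'I_n.*2} := [ffun i => Ordinal (xN i)].
  have f_incr (i j : 'I_4.*2) : i < j -> f i < f j.
    rewrite !ffunE /= => ij; apply: (sorted_ltn_nth ltn_trans) => //;
    by rewrite inE sz.
  have f_inj : injective f.
    move=> i j E; apply: val_inj => /=; case: (ltngtP i j) => // /f_incr;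
    by rewrite E ltnn.
  case/negP: av; apply/existsP; exists [set f @: (B : {set _}) | B in pattern_set Q].
  apply/existsP; exists f; apply/and4P; split=> //.
  + apply/subsetP => _ /imsetP[B + ->]; rewrite inE => /mapP[[a b] Qab ->] /=.
    have /and3P[/= a1 ab b8] := ordQ _ Qab.
    rewrite /arc8 imsetU1 imset_set1 -partner_eq //; last first.
      by rewrite (inj_eq f_inj) -val_eqE /= !inordK; lia.
    have := pQ _ Qab; rewrite !ffunE /= !inordK //; lia.
  + by rewrite card_imset ?card_pattern_set //; apply: imset_inj.
  + by apply/forallP => i; apply/forallP => j; apply/implyP/f_incr.
- move=> av; apply/negP => /existsP[A /existsP[f /and4P[AM _ /forallP f_incr /eqP EA]]].
  have incr (i j : 'I_8) : i < j -> f i < f j by have /forallP/(_ j)/implyP := f_incr i.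
  have /negP[] := av [seq nat_of_ord (f (inord i)) | i <- iota 0 8].
  have nthE i : i < 8 ->
      nth 0 [seq nat_of_ord (f (inord i)) | i <- iota 0 8] i = f (inord i).
    by move=> i8; rewrite (nth_map 0) ?size_iota // nth_iota.
  apply/and4P; split.
  + by rewrite size_map.
  + rewrite sorted_map; apply: (sub_in_sorted (P := fun i => i < 8) _ _
      (iota_ltn_sorted 0 8)) => //.
    by move=> i j i8 j8 ij; apply: incr; rewrite !inordK.
  + by apply/allP => _ /mapP[i _ ->]; apply: ltn_ord.
  + apply/allP => -[a b] Qab /=; have /and3P[/= a1 ab b8] := ordQ _ Qab.
    rewrite !nthE; [|lia..].
    have lt : f (inord a.-1) < f (inord b.-1) by apply: incr; rewrite !inordK; lia.
    rewrite partner_eq //; last by rewrite -val_eqE /= neq_ltn lt orbT.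
    have <- : f @: arc8 a b = [set f (inord a.-1); f (inord b.-1)].
      by rewrite /arc8 imsetU1 imset_set1.
    apply: (subsetP AM); rewrite EA; apply: imset_f.
    by rewrite inE; apply/mapP; exists (a, b).
Qed.

Lemma mem_stoimenow_avoiding n Qs M : all wf_pattern Qs ->
  M \in stoimenow_avoiding n [set:: map pattern_set Qs] <->
  [/\ is_matching M, stoimenow_involution n.*2 (partner M)
    & {in Qs, forall Q, avoiding n.*2 (partner M) Q}].
Proof.
move=> /allP wfQ; rewrite inE; split.
- move=> /andP[st /forall_inP av]; have /and3P[mat _ _] := st; split=> //.
    exact/partner_stoimenow.
  move=> Q QQs; apply/avoids_pattern => //; first exact: wfQ.
  by apply: av; rewrite inE map_f.
- case=> mat st av; apply/andP; split; first exact/partner_stoimenow.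
  apply/forall_inP => P; rewrite inE => /mapP[Q QQs ->].
  by apply/avoids_pattern; [| apply: wfQ | apply: av].
Qed.

(** * Counting a parametrized class *)

Definition arc_set n (op cl : nat -> nat) : {set {set 'I_n.*2}} :=
  [set [set i : 'I_n.*2 | (i == op k :> nat) || (i == cl k :> nat)] | k : 'I_n].

Lemma arc_setP n op cl (B : {set 'I_n.*2}) : arc_system n op cl ->
  B \in arc_set n op cl -> exists k : 'I_n, exists i j : 'I_n.*2,
    [/\ i = op k :> nat, j = cl k :> nat, i < j & B = [set i; j]].
Proof.
move=> [oc cN _ _ _] /imsetP[k _ ->].
have ock := oc k (ltn_ord k); have cNk := cN k (ltn_ord k).
exists k, (Ordinal (ltn_trans ock cNk)), (Ordinal cNk); split=> //.
by apply/setP => x; rewrite !inE -!val_eqE.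
Qed.

Lemma mem_arc_set n op cl (k : nat) (i j : 'I_n.*2) : k < n ->
  i = op k :> nat -> j = cl k :> nat -> [set i; j] \in arc_set n op cl.
Proof.
move=> kn ik jk; apply/imsetP; exists (Ordinal kn) => //.
by apply/setP => x; rewrite !inE -!val_eqE /= -ik -jk.
Qed.

Lemma card_arc_set n op cl : arc_system n op cl -> #|arc_set n op cl| = n.
Proof.
move=> [oc cN oinj _ onc]; rewrite card_imset ?card_ord // => k l /setP E.
have ock := oc k (ltn_ord k); have cNk := cN k (ltn_ord k).
have := E (Ordinal (ltn_trans ock cNk)); rewrite !inE /= eqxx /=.
move=> /esym/orP[] /eqP; first by move/(oinj _ _ (ltn_ord k) (ltn_ord l))/val_inj.
by move/eqP; rewrite (negPf (onc _ _ (ltn_ord k) (ltn_ord l))).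
Qed.

Lemma arc_set_matching n op cl : arc_system n op cl ->
  is_matching (arc_set n op cl).
Proof.
move=> sys; have [oc cN oinj cinj onc] := sys.
have card2 B : B \in arc_set n op cl -> #|B| = 2.
  case/(arc_setP sys) => k [i [j [_ _ ij ->]]].
  by rewrite cards2 -val_eqE neq_ltn ij.
have triv : trivIset (arc_set n op cl).
  apply/trivIsetP => A B /imsetP[k _ ->] /imsetP[l _ ->]; apply: contraR.
  case/pred0Pn => x; rewrite !inE => /andP[xk xl].
  suff -> : k = l by [].
  apply: val_inj => /=; have [kn ln] := (ltn_ord k, ltn_ord l).
  case/orP: xk => /eqP xk; case/orP: xl => /eqP xl.
  - by apply: oinj; rewrite // -xk.
  - by have := onc _ _ kn ln; rewrite -xk -xl eqxx.
  - by have := onc _ _ ln kn; rewrite -xk -xl eqxx.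
  - by apply: cinj; rewrite // -xk.
apply/andP; split; last by apply/forall_inP => B /card2 ->.
apply/and3P; split=> //; last by apply/negP => /card2; rewrite cards0.
rewrite eqEcard subsetT cardsT card_ord -(eqP triv) (eq_bigr _ card2).
by rewrite sum_nat_const card_arc_set // muln2 leqnn.
Qed.

Lemma card_matching n (M : {set {set 'I_n.*2}}) : is_matching M -> #|M| = n.
Proof.
move=> /andP[part /forall_inP card2].
have uniform : {in M, forall A : {set 'I_n.*2}, #|A| = 2}.
  by move=> A /card2/eqP.
have := card_uniform_partition uniform part.
by rewrite cardsT card_ord; lia.
Qed.

Lemma arc_set_realizes n op cl : arc_system n op cl ->
  realizes n op cl (partner (arc_set n op cl)).
Proof.
move=> sys; have mat := arc_set_matching sys; have [oc cN _ _ _] := sys.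
have arc k : k < n -> partner (arc_set n op cl) (op k) = cl k.
  move=> kn; have ock := oc k kn; have cNk := cN k kn.
  have oN := ltn_trans ock cNk; apply/eqP.
  rewrite (partner_eq (i := Ordinal oN) (j := Ordinal cNk)) //.
    exact: mem_arc_set kn _ _.
  by rewrite -val_eqE /= neq_ltn ock orbT.
split=> //; first exact: partner_matching.
move=> x xN xp; have [j [ji ijM]] := matching_block (Ordinal xN) mat.
have [k [i' [j' [ik jk ij E]]]] := arc_setP sys ijM.
exists k => //; rewrite -ik.
have : Ordinal xN \in [set i'; j'] by rewrite -E !inE eqxx.
rewrite !inE => /orP[/eqP <- //|/eqP xj].
have pj : partner (arc_set n op cl) j' = i'.
  by apply: (invol_sym (partner_matching mat)); rewrite // ik arc.
by move: xp; rewrite [x](congr1 val xj : x = j') pj; lia.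
Qed.

(** A matching has exactly n blocks, so it is enough to find n arcs in M; no
point has to be located in the list of arcs. *)
Lemma arc_set_complete n op cl (M : {set {set 'I_n.*2}}) :
  arc_system n op cl -> is_matching M ->
  (forall k, k < n -> partner M (op k) = cl k) -> M = arc_set n op cl.
Proof.
move=> sys mat arc; apply/esym/eqP; rewrite eqEcard card_arc_set //.
rewrite card_matching // leqnn andbT; apply/subsetP => B.
case/(arc_setP sys) => k [i [j [ik jk ij ->]]].
by rewrite -partner_eq // ?ik ?arc ?jk // -val_eqE neq_ltn ij orbT.
Qed.

(** Apart from (n, n, n), the valid triples 1 <= u <= v <= w <= n - 1 correspond
to the strictly increasing triples (u - 1, v, w + 1) in [0, n], whence the
binomial coefficient. *)
Lemma count_parametrized n Qs op cl : all wf_pattern Qs ->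
  parametrizes n Qs op cl ->
  #|stoimenow_avoiding n [set:: map pattern_set Qs]| = 'C(n.+1, 3).+1.
Proof.
move=> wfQ [sys sound complete inj].
pose F u v w := arc_set n (op u v w) (cl u v w).
have F_inj u v w u' v' w' : valid n u v w -> valid n u' v' w' ->
    F u v w = F u' v' w' -> [/\ u = u', v = v' & w = w'].
  move=> val val' E; apply: (inj _ _ _ _ _ _ (partner (F u v w)) val val').
    exact: arc_set_realizes (sys _ _ _ val).
  by rewrite E; apply: arc_set_realizes (sys _ _ _ val').
have F_mem u v w : valid n u v w ->
    F u v w \in stoimenow_avoiding n [set:: map pattern_set Qs].
  move=> val; have re := arc_set_realizes (sys _ _ _ val).
  have [st av] := sound _ _ _ _ val re.
  apply/mem_stoimenow_avoiding => //; split=> //.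
  exact: arc_set_matching (sys _ _ _ val).
pose T := [set t : 3.-tuple 'I_n.+1 | sorted ltn (map val t)].
pose E (t : 3.-tuple 'I_n.+1) i := nth 0 (map val t) i.
pose G t := F (E t 0).+1 (E t 1) (E t 2).-1.
have T_incr t : t \in T -> [&& E t 0 < E t 1, E t 1 < E t 2 & E t 2 <= n].
  rewrite inE /E; case: t => -[|a [|b [|c [|? ?]]]] //= _.
  by rewrite andbT => /andP[-> ->]; rewrite -ltnS ltn_ord.
have T_valid t : t \in T -> valid n (E t 0).+1 (E t 1) (E t 2).-1.
  by move/T_incr; rewrite /valid; lia.
have T_inj t t' : (forall i, i < 3 -> E t i = E t' i) -> t = t'.
  move=> eqE; apply/val_inj/(inj_map val_inj)/(@eq_from_nth _ 0).
    by rewrite !size_map !size_tuple.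
  by move=> i; rewrite size_map size_tuple; apply: eqE.
have valid_nnn : valid n n n n by rewrite /valid !eqxx orbT.
have -> : stoimenow_avoiding n [set:: map pattern_set Qs] =
    F n n n |: G @: T.
  apply/setP => M; apply/idP/setU1P.
    move=> /(mem_stoimenow_avoiding _ wfQ)[mat st av].
    have [u [v [w [val arc]]]] := complete _ st av.
    have -> : M = F u v w by apply: arc_set_complete arc => //; exact: sys.
    move: val => /orP[/and4P[u0 uv vw wn]|/and3P[/eqP-> /eqP-> /eqP->]]; last by left.
    right; apply/imsetP.
    have [x1 x2 x3] : [/\ u.-1 < n.+1, v < n.+1 & w.+1 < n.+1] by split; lia.
    exists [tuple Ordinal x1; Ordinal x2; Ordinal x3]; rewrite ?inE /=; first by lia.
    by rewrite /G /E /= prednK.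
  case=> [->|/imsetP[t tT ->]]; apply: F_mem => //; exact: T_valid.
rewrite cardsU1 card_in_imset ?card_ltn_sorted_tuples; last first.
  move=> t t' tT t'T eqG.
  have [e0 e1 e2] := F_inj _ _ _ _ _ _ (T_valid _ tT) (T_valid _ t'T) eqG.
  apply: T_inj => -[|[|[|//]]] _ //; first by case: e0.
  by have := T_incr _ tT; have := T_incr _ t'T; lia.
case: imsetP => // -[t tT eqF].
have [] := F_inj _ _ _ _ _ _ valid_nnn (T_valid _ tT) eqF.
by have := T_incr _ tT; lia.
Qed.

(** * The generating function *)

Local Open Scope ring_scope.

(** The coefficient of index n in f * g determines g n from the earlier ones. *)
Lemma fps_inv_unique (R : fieldType) (f g : fps R) : f 0%N != 0 ->
  fps_mul f g =1 fps_of_poly 1 -> fps_inv f =1 g.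
Proof.
move=> f0 fg; elim/ltn_ind => n IH.
have := fg n; rewrite -(fps_mulfV f0 n) /fps_mul !big_ord_recl !subn0.
rewrite (eq_bigr (fun i : 'I_n => f (lift ord0 i) * fps_inv f (n - lift ord0 i)%N)).
  by move/addIr/(mulfI f0).
by move=> i _; rewrite IH // lift0; have := ltn_ord i; lia.
Qed.

(** From the index size s on, the convolution has a fixed number of terms and
can be expanded. *)
Lemma fps_mul_poly (R : fieldType) (s : seq R) (g : fps R) n :
  fps_mul (fps_of_poly (Poly s)) g (n + size s) =
  \sum_(i < size s) s`_i * g (n + size s - i)%N.
Proof.
rewrite /fps_mul (big_ord_widen (n + size s).+1
  (fun i => s`_i * g (n + size s - i)%N)); last by lia.
rewrite [RHS]big_mkcond /=; apply: eq_bigr => i _; rewrite /fps_of_poly coef_Poly.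
by case: ltnP => // le_si; rewrite nth_default // mul0r.
Qed.

(** Turns identities between binomial coefficients into polynomial ones. *)
Lemma bin3_rat n : 'C(n.+3, 3)%:R = (n%:R + 1) * (n%:R + 2) * (n%:R + 3) / 6%:R :> rat.
Proof.
have : ('C(n.+3, 3) * 6 = (n + 1) * (n + 2) * (n + 3))%N.
  by rewrite -[6%N]/(3`!)%N bin_ffact !ffactnS ffactn0 /=; lia.
move/(congr1 (fun k => k%:R : rat)); rewrite !natrM !natrD => E.
by rewrite -E mulfK.
Qed.

Lemma fps_inv_pow4 : fps_inv (fps_of_poly ((1 - 'X) ^+ 4 : {poly rat})) =1
  fun n => 'C(n.+3, 3)%:R.
Proof.
have -> : (1 - 'X) ^+ 4 = Poly [:: 1; - 4%:R; 6%:R; - 4%:R; 1] :> {poly rat}.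
  rewrite /= !cons_poly_def !polyCN !polyC_natr polyC1; ring.
apply: fps_inv_unique; first by rewrite /fps_of_poly coef_Poly.
move=> n; have [n5|n5] := ltnP n 5.
  case: n n5 => [|[|[|[|[|n]]]]] // _;
  by rewrite /fps_mul !big_ord_recr big_ord0 /fps_of_poly !coef_Poly coef1 /=
    ?subSS ?subn0 !bin3_rat; lra.
rewrite -(subnK n5) [5%N in LHS]/(size [:: 1 : rat; - 4%:R; 6%:R; - 4%:R; 1]).
rewrite fps_mul_poly /fps_of_poly coef1 addn_eq0 andbF !big_ord_recr big_ord0 /=.
set m := (n - 5)%N; rewrite !bin3_rat -!addnBA // !natrD.
rewrite !subSS !subn0; by field.
Qed.

Lemma gf_coef n :
  fps_div (fps_of_poly (1 - 3%:R *: 'X + 4%:R *: 'X^2 - 'X^3))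
    (fps_of_poly ((1 - 'X) ^+ 4)) n = ('C(n.+1, 3).+1)%:R :> rat.
Proof.
have -> : 1 - 3%:R *: 'X + 4%:R *: 'X^2 - 'X^3 =
    Poly [:: 1; - 3%:R; 4%:R; - 1] :> {poly rat}.
  by rewrite /= !cons_poly_def -!mul_polyC !polyCN !polyC_natr polyC1; ring.
have -> : fps_div (fps_of_poly (Poly [:: 1; - 3%:R; 4%:R; - 1]))
    (fps_of_poly ((1 - 'X) ^+ 4)) n =
  fps_mul (fps_of_poly (Poly [:: 1; - 3%:R; 4%:R; - 1]))
    (fun k => 'C(k.+3, 3)%:R : rat) n.
  by apply: eq_bigr => i _; rewrite fps_inv_pow4.
rewrite -['C(_, _).+1%:R]natr1; have [n4|n4] := ltnP n 4.
  case: n n4 => [|[|[|[|n]]]] // _;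
  rewrite /fps_mul !big_ord_recr big_ord0 /fps_of_poly !coef_Poly /=
    ?subSS ?subn0 ?(bin_small (isT : (1 < 3)%N))
    ?(bin_small (isT : (2 < 3)%N)) !bin3_rat; lra.
rewrite -(subnK n4) [4%N in LHS]/(size [:: 1 : rat; - 3%:R; 4%:R; - 1]).
rewrite fps_mul_poly !big_ord_recr big_ord0 /=.
set m := (n - 4)%N.
rewrite (_ : (m + 4).+1 = m.+2.+3)%N; last by lia.
rewrite !bin3_rat -!addnBA // !natrD -[m.+2%:R]natr1 -[m.+1%:R]natr1.
rewrite !subSS !subn0; by field.
Qed.

(** * The three quadruples of patterns *)

Lemma set4_seq (T : finType) (a b c d : T) :
  [set a; b; c; d] = [set:: [:: a; b; c; d]].
Proof. by apply/setP => x; rewrite !inE -!orbA. Qed.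

Lemma eq_pattern_set Q Q' : perm_eq Q Q' -> pattern_set Q = pattern_set Q'.
Proof.
move=> perm_Q; apply/setP => B; rewrite !inE.
exact: perm_mem (perm_map _ perm_Q) B.
Qed.

Lemma card_stoimenow_avoiding (S : {set {set {set 'I_4.*2}}})
    (hS : S \in [:: [set P1; P2; P3; P4];
                    [set P1; P2; P3; P5];
                    [set P2; P3; P4; P5]]) :
  forall n, #|stoimenow_avoiding n S| = 'C(n.+1, 3).+1%N.
Proof.
have P1E : P1 = pattern_set pattern1 by apply: set4_seq.
have P2E : P2 = pattern_set pattern2 by apply: set4_seq.
have P3E : P3 = pattern_set pattern3 by apply: set4_seq.
have P4E : P4 = pattern_set pattern4 by apply: set4_seq.
have P5E : P5 = pattern_set pattern5 by apply: set4_seq.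
have P1E' : P1 = pattern_set (flip_pattern pattern1).
  by rewrite P1E; apply: eq_pattern_set.
have P2E' : P2 = pattern_set (flip_pattern pattern2).
  by rewrite P2E; apply: eq_pattern_set.
have P3E' : P3 = pattern_set (flip_pattern pattern3).
  by rewrite P3E; apply: eq_pattern_set.
have P5E' : P5 = pattern_set (flip_pattern pattern4).
  by rewrite P5E; apply: eq_pattern_set.
move=> n; move: hS; rewrite !inE => /or3P[] /eqP->.
- rewrite set4_seq P1E P2E P3E P4E.
  exact: (count_parametrized
    (Qs := [:: pattern1; pattern2; pattern3; pattern4]) isT (cross_parametrizes n)).
- rewrite set4_seq P1E' P2E' P3E' P5E'.
  by refine (count_parametrized _ (flip_parametrizes _ (cross_parametrizes n))).
- rewrite set4_seq P2E P3E P4E P5E.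
  exact: (count_parametrized
    (Qs := [:: pattern2; pattern3; pattern4; pattern5]) isT (span_parametrizes n)).
Qed.

Theorem theorem5p1 (S : {set {set {set 'I_4.*2}}})
    (hS : S \in [:: [set P1; P2; P3; P4];
                    [set P1; P2; P3; P5];
                    [set P2; P3; P4; P5]]) :
  stoimenow_gf S =1
    fps_div (fps_of_poly (1 - 3%:R *: 'X + 4%:R *: 'X^2 - 'X^3))
            (fps_of_poly ((1 - 'X) ^+ 4)).
Proof.
by move=> n; rewrite gf_coef /stoimenow_gf card_stoimenow_avoiding.
Qed.
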